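(* Let $X$ be a Banach space, $k\in\mathbb{N}$, and $(x_s)_{s\in[\mathbb{N}]^k}$ a weakly relatively compact $k$-sequence in $X$. Then there exists an infinite $M\subseteq\mathbb{N}$ such that at least one of the following holds: (1) $(x_s)_{s\in[M]^k}$ generates a $k$-spreading model equivalent to the usual basis of $\ell^1$; (2) there exists $x_0\in X$ such that for every infinite $L\subseteq M$, $(x_s)_{s\in[L]^k}$ is $k$-Cesàro summable to $x_0$.
   Context: $[M]^k$: $k$-subsets of $M\subseteq\mathbb{N}$ (increasing enumerations, $M(l)$ the $l$-th element); $M|n=\{M(1),\dots,M(n)\}$. A $k$-sequence is a map $[\mathbb{N}]^k\to X$; it is weakly relatively compact if the weak closure of $\{x_s:s\in[\mathbb{N}]^k\}$ is weakly compact. Plegma family: $(s_j)_{j=1}^l$ in $[M]^k$ with $s_1(i)<\dots<s_l(i)$ ($i\le k$), $s_l(i)<s_1(i+1)$ ($i<k$). $(x_s)_{s\in[M]^k}$ generates the Hamel basis $(e_n)$ of a seminormed space $(E,\|\cdot\|_* )$ as a $k$-spreading model if for a null sequence $\delta_l>0$: $|\|\sum_{j=1}^m a_jx_{s_j}\|-\|\sum_{j=1}^m a_je_j\|_*|\le\delta_l$ for all $m\le l$, plegma $(s_j)_{j=1}^m$ in $[M]^k$ with $s_1(1)\ge M(l)$, $a_j\in[-1,1]$. $(x_s)_{s\in[L]^k}$ is $k$-Cesàro summable to $x_0$ if $\binom{n}{k}^{-1}\sum_{s\in[L|n]^k}x_s\to x_0$ in norm. *)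

(* Defs.v *)
From Stdlib Require Import Reals Lra Lia List.
Import ListNotations.
Open Scope R_scope.

Record VecSpace := {
  vcar :> Type;
  vzero : vcar;
  vadd : vcar -> vcar -> vcar;
  vopp : vcar -> vcar;
  vscal : R -> vcar -> vcar;
  vadd_assoc : forall x y z, vadd x (vadd y z) = vadd (vadd x y) z;
  vadd_comm : forall x y, vadd x y = vadd y x;
  vadd_zero : forall x, vadd vzero x = x;
  vadd_opp : forall x, vadd x (vopp x) = vzero;
  vscal_one : forall x, vscal 1 x = x;
  vscal_assoc : forall a b x, vscal a (vscal b x) = vscal (a * b) x;
  vscal_distr_r : forall a b x, vscal (a + b) x = vadd (vscal a x) (vscal b x);
  vscal_distr_l : forall a x y, vscal a (vadd x y) = vadd (vscal a x) (vscal a y)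
}.

Record Seminormed := {
  sn_space :> VecSpace;
  snorm : sn_space -> R;
  snorm_triangle : forall x y, snorm (vadd _ x y) <= snorm x + snorm y;
  snorm_homog : forall a x, snorm (vscal _ a x) = Rabs a * snorm x
}.

Definition vsub {V : VecSpace} (x y : V) : V := vadd V x (vopp V y).

Record Banach := {
  bn_space :> Seminormed;
  bn_definite : forall x : bn_space, snorm bn_space x = 0 -> x = vzero bn_space;
  bn_complete : forall u : nat -> bn_space,
    (forall eps, eps > 0 -> exists N, forall n m, (n >= N)%nat -> (m >= N)%nat ->
        snorm bn_space (vsub (u n) (u m)) < eps) ->
    exists l : bn_space, forall eps, eps > 0 -> exists N, forall n, (n >= N)%nat ->
        snorm bn_space (vsub (u n) l) < eps
}.

Fixpoint lincomb {V : VecSpace} (a : nat -> R) (v : nat -> V) (m : nat) : V :=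
  match m with
  | O => vzero V
  | S m' => vadd V (lincomb a v m') (vscal V (a m') (v m'))
  end.

Definition hamel_basis {V : VecSpace} (e : nat -> V) : Prop :=
  (forall x : V, exists (m : nat) (a : nat -> R), x = lincomb a e m) /\
  (forall (m : nat) (a : nat -> R), lincomb a e m = vzero V ->
      forall j, (j < m)%nat -> a j = 0).

Definition bounded_linear_functional (X : Banach) (f : X -> R) : Prop :=
  (forall x y, f (vadd X x y) = f x + f y) /\
  (forall a x, f (vscal X a x) = a * f x) /\
  (exists C, forall x, Rabs (f x) <= C * snorm X x).

Definition weakly_open (X : Banach) (U : X -> Prop) : Prop :=
  forall x, U x -> exists (fs : list (X -> R)) (eps : R),
    eps > 0 /\ (forall f, In f fs -> bounded_linear_functional X f) /\
    (forall y, (forall f, In f fs -> Rabs (f y - f x) < eps) -> U y).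

Definition weakly_compact (X : Banach) (K : X -> Prop) : Prop :=
  forall (I : Type) (U : I -> X -> Prop),
    (forall i, weakly_open X (U i)) ->
    (forall x, K x -> exists i, U i x) ->
    exists (F : list I), forall x, K x -> exists i, In i F /\ U i x.

Definition weak_closure (X : Banach) (A : X -> Prop) : X -> Prop :=
  fun x => forall U, weakly_open X U -> U x -> exists y, U y /\ A y.

(** An infinite subset M of N is given by its strictly increasing enumeration
    (0-indexed): M i is the (i+1)-th element of M. *)
Definition infinite_enum (M : nat -> nat) : Prop := forall i, (M i < M (S i))%nat.

Definition sub_enum (L M : nat -> nat) : Prop := forall i, exists j, L i = M j.

(** A k-subset is a strictly increasing list of length k; s(i+1) = nth i s 0. *)
Definition strictly_inc (s : list nat) : Prop :=
  forall i, (S i < length s)%nat -> (nth i s 0 < nth (S i) s 0)%nat.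

Definition ksubset_of (M : nat -> nat) (k : nat) (s : list nat) : Prop :=
  length s = k /\ strictly_inc s /\
  forall i, (i < k)%nat -> exists j, nth i s 0%nat = M j.

Definition ksequence (X : Type) := list nat -> X.

Definition weakly_rel_compact_kseq (X : Banach) (k : nat) (x : ksequence X) : Prop :=
  weakly_compact X (weak_closure X (fun y => exists s, ksubset_of (fun i => i) k s /\ y = x s)).

Definition plegma (M : nat -> nat) (k m : nat) (s : nat -> list nat) : Prop :=
  (forall j, (j < m)%nat -> ksubset_of M k (s j)) /\
  (forall i j, (i < k)%nat -> (S j < m)%nat ->
      (nth i (s j) 0 < nth i (s (S j)) 0)%nat) /\
  (forall i, (S i < k)%nat -> (0 < m)%nat ->
      (nth i (s (pred m)) 0 < nth (S i) (s 0%nat) 0)%nat).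

(** (x_s)_{s in [M]^k} generates the Hamel basis e of E as a k-spreading model.
    Index shift: paper's l corresponds to l+1 here, so M(l) (paper) = M l' with
    l = l'+1, and delta l' plays the role of delta_{l'+1}. *)
Definition generates_spreading_model (X : Banach) (k : nat) (x : ksequence X)
    (M : nat -> nat) (E : Seminormed) (e : nat -> E) : Prop :=
  hamel_basis e /\
  exists delta : nat -> R,
    (forall l, delta l > 0) /\
    (forall eps, eps > 0 -> exists N, forall l, (l >= N)%nat -> delta l < eps) /\
    forall (l m : nat) (s : nat -> list nat) (a : nat -> R),
      (m <= S l)%nat -> plegma M k m s ->
      (0 < m)%nat -> (nth 0 (s 0%nat) 0 >= M l)%nat ->
      (forall j, (j < m)%nat -> -1 <= a j <= 1) ->
      Rabs (snorm X (lincomb a (fun j => x (s j)) m) - snorm E (lincomb a e m))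
        <= delta l.

Definition equiv_l1_basis (E : Seminormed) (e : nat -> E) : Prop :=
  exists c C : R, c > 0 /\
    forall (m : nat) (a : nat -> R),
      c * (fold_right Rplus 0 (map (fun j => Rabs (a j)) (seq 0 m)))
        <= snorm E (lincomb a e m) <=
      C * (fold_right Rplus 0 (map (fun j => Rabs (a j)) (seq 0 m))).

Fixpoint ksubsets (k : nat) (l : list nat) : list (list nat) :=
  match k with
  | O => [ [] ]
  | S k' =>
    match l with
    | [] => []
    | h :: t => map (cons h) (ksubsets k' t) ++ ksubsets (S k') t
    end
  end.

Definition vsum_list {V : VecSpace} (xs : list V) : V :=
  fold_right (vadd V) (vzero V) xs.

Definition cesaro_summable (X : Banach) (k : nat) (x : ksequence X)
    (L : nat -> nat) (x0 : X) : Prop :=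
  forall eps, eps > 0 -> exists N, forall n, (n >= N)%nat ->
    snorm X (vsub (vscal X (/ Binomial.C n k)
                     (vsum_list (map x (ksubsets k (map L (seq 0 n)))))) x0) < eps.

(* Main.v *)
(** Fix a free ultrafilter U on the natural numbers. Iterated weak limits of the k-sequence along
    U give a point x0 of its weak closure. A plegma family of m sets is the same as an increasing
    list of length m k, read modulo m, so that "for almost all plegma families" means m k nested
    quantifiers along U, and a diagonal argument makes any such statements hold on an infinite M.

    For th > 0 and m, ask whether almost all plegma m-families admit a functional f of norm at
    most 1 with f (x_s_j) >= f x0 + th for all j.

    - If for some th this holds for every m, then weak lower semicontinuity of convex Lipschitz
      functions lets one replace the terms with negative coefficients by x0 in the iterated limit
      of |sum a_j x_s_j|, which gives the lower l^1 estimate (th / 4) sum |a_j|; the limit norm is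
      the spreading model.

    - Otherwise every th has an m for which almost no plegma m-family is separated. If f norms
      the difference of a Cesaro mean and x0, then for most k-sets p fewer than m of the translates
      p, p + 1, ..., p + W - 1 satisfy f x >= f x0 + th, because such translates form a plegma
      family; averaging over translations shows that the difference is small. *)
Require Import Defs.
From Stdlib Require Import Reals Lra Lia List Classical ClassicalEpsilon.
From Stdlib Require Import FunctionalExtensionality ProofIrrelevance.
From mathcomp Require classical_sets filter.
Import ListNotations.
Open Scope R_scope.

(** In the first case the obstacle is the interleaving: the entries of the sets of a plegma family
    are quantified in turn, so no [x s_j] can be replaced by its weak limit in a single step. The
    replacement goes entry by entry, a partially known set being represented by the iterated weak
    limit over its missing entries. The terms with nonnegative coefficients stay, because a
    separating functional, which may change with the family, bounds exactly these from below. If N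
    is the limit norm, this gives th times the sum of the positive parts <= N + |sum a_j| |x0| <= 2
    N; adding the same bound for -a produces the constant th / 4. In the second case the failure of
    separation concerns all functionals at once. Hence f may be chosen after n, norming the error of
    the n-th mean, and the estimate becomes one in norm. The point x0 is fixed before M, so it
    serves every L. *)

Notation "x ⊕ y" := (vadd _ x y) (at level 50, left associativity).
Notation "x ⊖ y" := (vsub x y) (at level 50, left associativity).
Notation "a ⊙ x" := (vscal _ a x) (at level 40, left associativity).

(** * Linear identities in a vector space *)

Section VectorIdentities.
Variable V : VecSpace.

Lemma vadd_zero_r (x : V) : x ⊕ vzero V = x.
Proof. rewrite vadd_comm. apply vadd_zero. Qed.

Lemma vadd_cancel_l (x y z : V) : x ⊕ y = x ⊕ z -> y = z.
Proof.
  intros H. rewrite <- (vadd_zero V y), <- (vadd_zero V z).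
  rewrite <- (vadd_opp V x), (vadd_comm V x (vopp V x)), <- !vadd_assoc, H.
  reflexivity.
Qed.

Lemma vscal_zero (x : V) : 0 ⊙ x = vzero V.
Proof.
  apply (vadd_cancel_l (0 ⊙ x)). rewrite <- vscal_distr_r, vadd_zero_r, Rplus_0_r.
  reflexivity.
Qed.

Lemma vscal_vzero (a : R) : a ⊙ vzero V = vzero V.
Proof.
  apply (vadd_cancel_l (a ⊙ vzero V)). rewrite <- vscal_distr_l, !vadd_zero_r.
  reflexivity.
Qed.

Lemma vopp_scal (x : V) : vopp V x = (-1) ⊙ x.
Proof.
  apply (vadd_cancel_l x). rewrite vadd_opp.
  transitivity (1 ⊙ x ⊕ (-1) ⊙ x).
  - rewrite <- vscal_distr_r. replace (1 + -1) with 0 by ring. now rewrite vscal_zero.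
  - now rewrite vscal_one.
Qed.

Lemma vadd_swap (a b c d : V) : a ⊕ b ⊕ (c ⊕ d) = a ⊕ c ⊕ (b ⊕ d).
Proof.
  rewrite <- !vadd_assoc. f_equal. rewrite !vadd_assoc. f_equal. apply vadd_comm.
Qed.

Lemma lincomb_ext (a b : nat -> R) (v w : nat -> V) m :
  (forall j, (j < m)%nat -> a j = b j) -> (forall j, (j < m)%nat -> v j = w j) ->
  lincomb a v m = lincomb b w m.
Proof.
  induction m as [|m IH]; simpl; intros Ha Hv; [reflexivity|].
  rewrite IH, Ha, Hv; auto.
Qed.

Lemma lincomb_plus (a b : nat -> R) (v : nat -> V) m :
  lincomb (fun j => a j + b j) v m = lincomb a v m ⊕ lincomb b v m.
Proof.
  induction m as [|m IH]; simpl; [now rewrite vadd_zero|].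
  rewrite IH, vscal_distr_r. apply vadd_swap.
Qed.

Lemma lincomb_scal (c : R) (a : nat -> R) (v : nat -> V) m :
  lincomb (fun j => c * a j) v m = c ⊙ lincomb a v m.
Proof.
  induction m as [|m IH]; simpl; [now rewrite vscal_vzero|].
  now rewrite IH, vscal_distr_l, vscal_assoc.
Qed.

Lemma lincomb_zero (a : nat -> R) (v : nat -> V) m :
  (forall j, (j < m)%nat -> a j = 0) -> lincomb a v m = vzero V.
Proof.
  induction m as [|m IH]; simpl; intros H; [reflexivity|].
  rewrite IH, H by auto. now rewrite vscal_zero, vadd_zero.
Qed.

Lemma lincomb_trunc (a : nat -> R) (v : nat -> V) m n :
  (m <= n)%nat -> (forall j, (m <= j)%nat -> a j = 0) -> lincomb a v n = lincomb a v m.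
Proof.
  intros Hmn Ha. induction Hmn as [|n Hmn IH]; [reflexivity|].
  simpl. rewrite Ha by assumption. now rewrite vscal_zero, vadd_zero_r, IH.
Qed.

(** Reflection for vector identities: an expression in finitely many atoms is determined by its
    coefficients, so [vlin] turns an identity into one real equation per atom. *)
Inductive vexp :=
| VVar (n : nat) | VZero | VAdd (a b : vexp) | VOpp (a : vexp) | VScal (r : R) (a : vexp).

Fixpoint veval (env : list V) (e : vexp) : V :=
  match e with
  | VVar n => nth n env (vzero V)
  | VZero => vzero V
  | VAdd a b => veval env a ⊕ veval env b
  | VOpp a => vopp V (veval env a)
  | VScal r a => r ⊙ veval env a
  end.

Fixpoint vcoef (e : vexp) (n : nat) : R :=
  match e with
  | VVar m => if Nat.eqb m n then 1 else 0
  | VZero => 0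
  | VAdd a b => vcoef a n + vcoef b n
  | VOpp a => (-1) * vcoef a n
  | VScal r a => r * vcoef a n
  end.

Lemma lincomb_delta (n N : nat) (v : nat -> V) :
  lincomb (fun j => if Nat.eqb n j then 1 else 0) v N =
  if Nat.ltb n N then v n else vzero V.
Proof.
  induction N as [|N IH]; simpl; [reflexivity|]. rewrite IH.
  destruct (Nat.eqb_spec n N) as [->|Hn].
  - rewrite Nat.ltb_irrefl, vadd_zero, vscal_one.
    destruct (Nat.ltb_spec N (S N)); [reflexivity|lia].
  - rewrite vscal_zero, vadd_zero_r.
    destruct (Nat.ltb_spec n N), (Nat.ltb_spec n (S N)); lia || reflexivity.
Qed.

Lemma veval_lincomb (env : list V) (e : vexp) :
  veval env e = lincomb (vcoef e) (fun j => nth j env (vzero V)) (length env).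
Proof.
  induction e as [n| |a IHa b IHb|a IHa|r a IHa]; simpl.
  - rewrite lincomb_delta. destruct (Nat.ltb_spec n (length env)) as [H|H]; [reflexivity|].
    now apply nth_overflow.
  - now rewrite lincomb_zero.
  - now rewrite IHa, IHb, <- lincomb_plus.
  - now rewrite IHa, vopp_scal, <- lincomb_scal.
  - now rewrite IHa, <- lincomb_scal.
Qed.

Fixpoint same_coef (N : nat) (e1 e2 : vexp) : Prop :=
  match N with
  | O => True
  | S N' => vcoef e1 N' = vcoef e2 N' /\ same_coef N' e1 e2
  end.

Lemma veval_same_coef (env : list V) (e1 e2 : vexp) :
  same_coef (length env) e1 e2 -> veval env e1 = veval env e2.
Proof.
  rewrite !veval_lincomb. generalize (length env) as N.
  intros N H. apply lincomb_ext; [|reflexivity].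
  induction N as [|N IH]; simpl in *; intros j Hj; [lia|].
  destruct (Nat.eq_dec j N) as [->|]; [tauto|]. apply IH; [tauto|lia].
Qed.

End VectorIdentities.

Ltac v_in t l :=
  lazymatch l with
  | nil => constr:(false)
  | t :: _ => constr:(true)
  | _ :: ?l' => v_in t l'
  end.

Ltac v_atoms t l :=
  lazymatch t with
  | vadd _ ?a ?b => let l' := v_atoms a l in v_atoms b l'
  | vsub ?a ?b => let l' := v_atoms a l in v_atoms b l'
  | vopp _ ?a => v_atoms a l
  | vscal _ _ ?a => v_atoms a l
  | vzero _ => l
  | _ => let b := v_in t l in
         lazymatch b with true => l | false => constr:(t :: l) end
  end.

Ltac v_index t l :=
  lazymatch l with
  | t :: _ => constr:(O)
  | _ :: ?l' => let n := v_index t l' in constr:(S n)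
  end.

Ltac v_reify t l :=
  lazymatch t with
  | vadd _ ?a ?b => let a' := v_reify a l in let b' := v_reify b l in constr:(VAdd a' b')
  | vsub ?a ?b => let a' := v_reify a l in let b' := v_reify b l in constr:(VAdd a' (VOpp b'))
  | vopp _ ?a => let a' := v_reify a l in constr:(VOpp a')
  | vscal _ ?r ?a => let a' := v_reify a l in constr:(VScal r a')
  | vzero _ => constr:(VZero)
  | _ => let n := v_index t l in constr:(VVar n)
  end.

Ltac vlin :=
  lazymatch goal with
  | |- @eq ?T ?a ?b =>
    let l := v_atoms a (@nil T) in
    let l := v_atoms b l in
    let e1 := v_reify a l in
    let e2 := v_reify b l in
    apply (veval_same_coef _ l e1 e2);
    cbn [length same_coef vcoef Nat.eqb]; repeat split
  end.

Ltac vring := vlin; ring.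
Ltac vfield := vlin; field.

(** * The Hahn-Banach theorem *)

Lemma inf_exists (A : R -> Prop) (b : R) :
  (exists r, A r) -> (forall r, A r -> b <= r) ->
  exists m, (forall r, A r -> m <= r) /\ (forall c, (forall r, A r -> c <= r) -> c <= m).
Proof.
  intros [r0 Hr0] Hb.
  destruct (completeness (fun r => A (- r))) as [m [Hm1 Hm2]].
  - exists (- b). intros r Hr. specialize (Hb _ Hr). lra.
  - exists (- r0). now rewrite Ropp_involutive.
  - exists (- m). split.
    + intros r Hr. assert (H : - r <= m); [|lra].
      apply Hm1. cbv beta. now rewrite Ropp_involutive.
    + intros c Hc. assert (H : m <= - c); [|lra].
      apply Hm2. intros r Hr. specialize (Hc _ Hr). lra.
Qed.

Section HahnBanach.
Variable V : VecSpace.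

Definition sublinear (q : V -> R) : Prop :=
  (forall x y, q (x ⊕ y) <= q x + q y) /\ (forall a x, 0 <= a -> q (a ⊙ x) = a * q x).

Lemma sublinear_zero q : sublinear q -> q (vzero V) = 0.
Proof. intros [_ H]. rewrite <- (vscal_zero V (vzero V)), H by lra. ring. Qed.

Lemma sublinear_opp q x : sublinear q -> - q (vopp V x) <= q x.
Proof.
  intros H. pose proof (sublinear_zero q H) as H0. destruct H as [H _].
  specialize (H x (vopp V x)). rewrite vadd_opp in H. lra.
Qed.

Definition sub_below (p : V -> R) := {q : V -> R | sublinear q /\ forall x, q x <= p x}.

(** The order is reversed, so that a maximal element in Zorn's lemma is a minimal sublinear
    functional. *)
Definition below_rel (p : V -> R) (q q' : sub_below p) : bool :=
  if excluded_middle_informative (forall x, proj1_sig q' x <= proj1_sig q x)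
  then true else false.

Lemma below_relP p (q q' : sub_below p) :
  below_rel p q q' = true <-> forall x, proj1_sig q' x <= proj1_sig q x.
Proof. unfold below_rel. destruct excluded_middle_informative; intuition congruence. Qed.

(** The bound is the pointwise infimum, which is finite because every member satisfies q x >= - q
    (-x) >= - p (-x). Subadditivity is where the total order of the chain enters. *)
Lemma chain_inf_sublinear (p : V -> R) (A : sub_below p -> Prop) :
  (forall s t, A s -> A t -> below_rel p s t = true \/ below_rel p t s = true) ->
  (exists s, A s) -> exists t, forall s, A s -> below_rel p s t = true.
Proof.
  intros Htot [s0 Hs0].
  assert (Hinf : forall x, exists m,
    (forall r, (exists s, A s /\ r = proj1_sig s x) -> m <= r) /\
    (forall c, (forall r, (exists s, A s /\ r = proj1_sig s x) -> c <= r) -> c <= m)).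
  { intros x. apply (inf_exists _ (- p (vopp V x))).
    - exists (proj1_sig s0 x). eauto.
    - intros r (s & _ & ->). destruct s as [q [Hq Hqp]]; simpl.
      pose proof (sublinear_opp q x Hq). specialize (Hqp (vopp V x)). lra. }
  set (g := fun x => proj1_sig (constructive_indefinite_description _ (Hinf x))).
  assert (Hg1 : forall x s, A s -> g x <= proj1_sig s x).
  { intros x s Hs. unfold g. destruct constructive_indefinite_description as [m [H1 H2]]; simpl.
    apply H1. eauto. }
  assert (Hg2 : forall x c, (forall s, A s -> c <= proj1_sig s x) -> c <= g x).
  { intros x c Hc. unfold g.
    destruct constructive_indefinite_description as [m [H1 H2]]; simpl.
    apply H2. intros r (s & Hs & ->). auto. }
  clearbody g.
  assert (Hsc : forall a x, 0 <= a -> a * g x <= g (a ⊙ x)).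
  { intros a x Ha. apply Hg2. intros s Hs.
    rewrite (proj2 (proj1 (proj2_sig s))) by assumption.
    apply Rmult_le_compat_l; auto. }
  assert (Hgs : sublinear g).
  { split.
    - intros x y. apply Rnot_lt_le. intros Hlt.
      (* two members of the chain witnessing smallness at x and y: use the lower one *)
      assert (Hw : forall z e, 0 < e -> exists s, A s /\ proj1_sig s z < g z + e).
      { intros z e He. apply NNPP. intros Hn. assert (Hc : g z + e <= g z); [|lra].
        apply Hg2. intros s Hs. apply Rnot_lt_le. intros Hl. apply Hn. eauto. }
      set (e := (g (x ⊕ y) - (g x + g y)) / 2).
      assert (He : 0 < e) by (unfold e; lra).
      destruct (Hw x e He) as (s & Hs & Hsx), (Hw y e He) as (t & Ht & Hty).
      assert (Hlow : exists r, A r /\ proj1_sig r x <= proj1_sig s x /\ proj1_sig r y <= proj1_sig t y).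
      { destruct (Htot s t Hs Ht) as [H|H]; rewrite below_relP in H.
        - exists t. repeat split; auto; lra.
        - exists s. repeat split; auto; lra. }
      destruct Hlow as (r & Hr & H1 & H2).
      pose proof (proj1 (proj1 (proj2_sig r)) x y) as H3.
      pose proof (Hg1 (x ⊕ y) r Hr). unfold e in *. lra.
    - intros a x Ha. apply Rle_antisym; [|now apply Hsc].
      destruct (Req_dec a 0) as [->|Ha0].
      + rewrite vscal_zero, Rmult_0_l.
        pose proof (Hg1 (vzero V) s0 Hs0) as H.
        now rewrite (sublinear_zero _ (proj1 (proj2_sig s0))) in H.
      + assert (Hpos : 0 < a) by lra.
        assert (Hi : 0 <= / a) by (left; now apply Rinv_0_lt_compat).
        pose proof (Hsc (/ a) (a ⊙ x) Hi) as H.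
        replace (/ a ⊙ (a ⊙ x)) with x in H by (vfield; lra).
        apply (Rmult_le_compat_l a) in H; [|lra].
        rewrite <- Rmult_assoc, Rinv_r, Rmult_1_l in H by lra. exact H. }
  assert (Hgp : forall x, g x <= p x).
  { intros x. apply Rle_trans with (1 := Hg1 x s0 Hs0). apply (proj2 (proj2_sig s0)). }
  exists (exist _ g (conj Hgs Hgp)). intros s Hs. rewrite below_relP. simpl. auto.
Qed.

Lemma minimal_sublinear_exists (p : V -> R) : sublinear p ->
  exists q, sublinear q /\ (forall x, q x <= p x) /\
    forall q', sublinear q' -> (forall x, q' x <= q x) -> forall x, q' x = q x.
Proof.
  intros Hp.
  destruct (@classical_sets.Zorn (sub_below p) (below_rel p)) as [[q [Hq Hqp]] Hmin].
  - intros t. apply below_relP. intros; lra.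
  - intros r s t. unfold is_true. rewrite !below_relP. intros H1 H2 x.
    specialize (H1 x). specialize (H2 x). lra.
  - intros [s Hs] [t Ht]. unfold is_true. rewrite !below_relP. simpl. intros H1 H2.
    assert (s = t) by (apply functional_extensionality; intros x; apply Rle_antisym; auto).
    subst t. f_equal. apply proof_irrelevance.
  - intros A HA. destruct (classic (exists s, A s)) as [Hne|Hne].
    + now apply chain_inf_sublinear.
    + exists (exist _ p (conj Hp (fun x => Rle_refl _))). intros s Hs. destruct Hne. eauto.
  - exists q. repeat split; try apply Hq; auto. intros q' Hq' Hle x.
    assert (Hq'p : forall x, q' x <= p x).
    { intros z. apply Rle_trans with (q z); auto. }
    specialize (Hmin (exist _ q' (conj Hq' Hq'p))). unfold is_true in Hmin.
    rewrite below_relP in Hmin. simpl in Hmin. specialize (Hmin Hle).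
    now injection Hmin as ->.
Qed.

(** The function g x = inf over t >= 0 of q (x + t v) - t q v is sublinear and lies below q, so it
    equals q by minimality. Its value at -v is at most q 0 - q v, by taking t = 1. *)
Lemma minimal_sublinear_odd (q : V -> R) : sublinear q ->
  (forall q', sublinear q' -> (forall x, q' x <= q x) -> forall x, q' x = q x) ->
  forall v, q (vopp V v) = - q v.
Proof.
  intros Hq Hmin v.
  assert (Hinf : forall x, exists m,
    (forall r, (exists t, 0 <= t /\ r = q (x ⊕ t ⊙ v) - t * q v) -> m <= r) /\
    (forall c, (forall r, (exists t, 0 <= t /\ r = q (x ⊕ t ⊙ v) - t * q v) -> c <= r) -> c <= m)).
  { intros x. apply (inf_exists _ (- q (vopp V x))).
    - exists (q (x ⊕ 0 ⊙ v) - 0 * q v), 0. split; [lra|reflexivity].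
    - intros r (t & Ht & ->).
      pose proof (proj1 Hq (vopp V x) (x ⊕ t ⊙ v)) as H.
      replace (vopp V x ⊕ (x ⊕ t ⊙ v)) with (t ⊙ v) in H by vring.
      rewrite (proj2 Hq) in H by assumption. lra. }
  set (g := fun x => proj1_sig (constructive_indefinite_description _ (Hinf x))).
  assert (Hg1 : forall x t, 0 <= t -> g x <= q (x ⊕ t ⊙ v) - t * q v).
  { intros x s Hs. unfold g. destruct constructive_indefinite_description as [m [H1 H2]]; simpl.
    apply H1. eauto. }
  assert (Hg2 : forall x c, (forall t, 0 <= t -> c <= q (x ⊕ t ⊙ v) - t * q v) -> c <= g x).
  { intros x c Hc. unfold g.
    destruct constructive_indefinite_description as [m [H1 H2]]; simpl.
    apply H2. intros r (s & Hs & ->). auto. }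
  clearbody g.
  assert (Hgq : forall x, g x <= q x).
  { intros x. specialize (Hg1 x 0 (Rle_refl _)).
    replace (x ⊕ 0 ⊙ v) with x in Hg1 by vring. lra. }
  assert (Hsc : forall a x, 0 < a -> a * g x <= g (a ⊙ x)).
  { intros a x Ha. apply Hg2. intros t Ht.
    assert (Hta : 0 <= t / a) by (apply Rmult_le_pos; [|left; apply Rinv_0_lt_compat]; lra).
    pose proof (Hg1 x (t / a) Hta) as H.
    apply (Rmult_le_compat_l a) in H; [|lra].
    replace (a * (q (x ⊕ t / a ⊙ v) - t / a * q v)) with
      (a * q (x ⊕ t / a ⊙ v) - t * q v) in H by (field; lra).
    rewrite <- (proj2 Hq) in H by lra.
    replace (a ⊙ (x ⊕ t / a ⊙ v)) with (a ⊙ x ⊕ t ⊙ v) in H by (vfield; lra).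
    exact H. }
  assert (Hgs : sublinear g).
  { split.
    - intros x y.
      assert (H : g (x ⊕ y) - g y <= g x); [|lra].
      apply Hg2. intros t Ht.
      assert (H : g (x ⊕ y) - (q (x ⊕ t ⊙ v) - t * q v) <= g y); [|lra].
      apply Hg2. intros s Hs.
      pose proof (Hg1 (x ⊕ y) (t + s) ltac:(lra)) as H1.
      replace (x ⊕ y ⊕ (t + s) ⊙ v) with ((x ⊕ t ⊙ v) ⊕ (y ⊕ s ⊙ v)) in H1 by vring.
      pose proof (proj1 Hq (x ⊕ t ⊙ v) (y ⊕ s ⊙ v)). lra.
    - intros a x Ha. destruct (Req_dec a 0) as [->|Ha0].
      + rewrite vscal_zero, Rmult_0_l. apply Rle_antisym.
        * rewrite <- (sublinear_zero q Hq). apply Hgq.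
        * apply Hg2. intros t Ht. rewrite vadd_zero, (proj2 Hq) by assumption. lra.
      + apply Rle_antisym; [|apply Hsc; lra].
        assert (Hi : 0 < / a) by (apply Rinv_0_lt_compat; lra).
        pose proof (Hsc (/ a) (a ⊙ x) Hi) as H.
        replace (/ a ⊙ (a ⊙ x)) with x in H by (vfield; lra).
        apply (Rmult_le_compat_l a) in H; [|lra].
        rewrite <- Rmult_assoc, Rinv_r, Rmult_1_l in H by lra. exact H. }
  pose proof (Hmin g Hgs Hgq (vopp V v)) as H.
  pose proof (Hg1 (vopp V v) 1 ltac:(lra)) as H1.
  replace (vopp V v ⊕ 1 ⊙ v) with (vzero V) in H1 by vring.
  rewrite (sublinear_zero q Hq) in H1.
  pose proof (sublinear_opp q v Hq). lra.
Qed.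

Theorem hahn_banach_sublinear (p : V -> R) : sublinear p ->
  exists f : V -> R, (forall x y, f (x ⊕ y) = f x + f y) /\
    (forall a x, f (a ⊙ x) = a * f x) /\ forall x, f x <= p x.
Proof.
  intros Hp. destruct (minimal_sublinear_exists p Hp) as (q & Hq & Hqp & Hmin).
  pose proof (minimal_sublinear_odd q Hq Hmin) as Hodd.
  exists q. split; [|split; [|assumption]].
  - intros x y. apply Rle_antisym; [apply Hq|].
    pose proof (proj1 Hq (x ⊕ y) (vopp V y)) as H.
    replace (x ⊕ y ⊕ vopp V y) with x in H by vring.
    rewrite Hodd in H. lra.
  - intros a x. destruct (Rle_lt_dec 0 a) as [Ha|Ha]; [now apply Hq|].
    replace (a ⊙ x) with (vopp V ((- a) ⊙ x)) by vring.
    rewrite Hodd, (proj2 Hq) by lra. ring.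
Qed.

End HahnBanach.

(** * Subgradients of convex functions and norming functionals *)

Definition dual_ball (E : Seminormed) (f : E -> R) : Prop :=
  (forall x y, f (x ⊕ y) = f x + f y) /\ (forall a x, f (a ⊙ x) = a * f x) /\
  (forall x, Rabs (f x) <= snorm E x).

Section NormFacts.
Variable E : Seminormed.

Lemma snorm_zero : snorm E (vzero E) = 0.
Proof. rewrite <- (vscal_zero E (vzero E)), snorm_homog, Rabs_R0. ring. Qed.

Lemma snorm_opp x : snorm E (vopp E x) = snorm E x.
Proof. rewrite vopp_scal, snorm_homog, Rabs_left by lra. ring. Qed.

Lemma snorm_nonneg x : 0 <= snorm E x.
Proof.
  pose proof (snorm_triangle E x (vopp E x)) as H.
  rewrite vadd_opp, snorm_opp, snorm_zero in H. lra.
Qed.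

Lemma snorm_sub_triangle x y : Rabs (snorm E x - snorm E y) <= snorm E (x ⊖ y).
Proof.
  apply Rabs_le. split.
  - pose proof (snorm_triangle E x (vopp E (x ⊖ y))) as H.
    replace (x ⊕ vopp E (x ⊖ y)) with y in H by vring.
    rewrite snorm_opp in H. lra.
  - pose proof (snorm_triangle E y (x ⊖ y)) as H.
    replace (y ⊕ (x ⊖ y)) with x in H by vring. lra.
Qed.

(* Hahn-Banach applied to the directional derivative of [phi] at [w]. *)
Lemma subgradient_exists (phi : E -> R) (w : E) :
  (forall x y, phi (x ⊕ y) <= phi x + snorm E y) ->
  (forall x y t, 0 <= t <= 1 ->
     phi (t ⊙ x ⊕ (1 - t) ⊙ y) <= t * phi x + (1 - t) * phi y) ->
  exists f, dual_ball E f /\ forall x, phi w + f (x ⊖ w) <= phi x.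
Proof.
  intros Hlip Hconv.
  assert (Hlip' : forall x y, phi x - snorm E y <= phi (x ⊕ y)).
  { intros x y. pose proof (Hlip (x ⊕ y) (vopp E y)) as H.
    replace (x ⊕ y ⊕ vopp E y) with x in H by vring. rewrite snorm_opp in H. lra. }
  assert (Hinf : forall h, exists m,
    (forall r, (exists t, 0 < t /\ r = (phi (w ⊕ t ⊙ h) - phi w) / t) -> m <= r) /\
    (forall c, (forall r, (exists t, 0 < t /\ r = (phi (w ⊕ t ⊙ h) - phi w) / t) -> c <= r) -> c <= m)).
  { intros h. apply (inf_exists _ (- snorm E h)).
    - exists ((phi (w ⊕ 1 ⊙ h) - phi w) / 1), 1. split; [lra|reflexivity].
    - intros r (t & Ht & ->).
      apply (Rmult_le_reg_r t); [assumption|].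
      unfold Rdiv. rewrite Rmult_assoc, Rinv_l, Rmult_1_r by lra.
      pose proof (Hlip' w (t ⊙ h)) as H. rewrite snorm_homog, Rabs_pos_eq in H by lra. lra. }
  set (g := fun x => proj1_sig (constructive_indefinite_description _ (Hinf x))).
  assert (Hg1 : forall x t, 0 < t -> t * g x <= phi (w ⊕ t ⊙ x) - phi w).
  { intros x s Hs. unfold g. destruct constructive_indefinite_description as [m [H1 H2]]; simpl.
    apply (Rmult_le_reg_r (/ s)); [now apply Rinv_0_lt_compat|].
    replace (s * m * / s) with m by (field; lra). apply H1. exists s. split; [assumption|reflexivity]. }
  assert (Hg2 : forall x c, (forall t, 0 < t -> t * c <= phi (w ⊕ t ⊙ x) - phi w) -> c <= g x).
  { intros x c Hc. unfold g.
    destruct constructive_indefinite_description as [m [H1 H2]]; simpl.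
    apply H2. intros r (s & Hs & ->).
    apply (Rmult_le_reg_l s); [assumption|].
    replace (s * ((phi (w ⊕ s ⊙ x) - phi w) / s)) with (phi (w ⊕ s ⊙ x) - phi w) by (field; lra).
    auto. }
  clearbody g.
  assert (Hgn : forall x, g x <= snorm E x).
  { intros x. pose proof (Hg1 x 1 ltac:(lra)) as H.
    replace (w ⊕ 1 ⊙ x) with (w ⊕ x) in H by vring.
    pose proof (Hlip w x). lra. }
  assert (Hsc : forall a x, 0 < a -> a * g x <= g (a ⊙ x)).
  { intros a x Ha. apply Hg2. intros t Ht.
    pose proof (Hg1 x (t * a) ltac:(now apply Rmult_lt_0_compat)) as H.
    replace (t ⊙ (a ⊙ x)) with ((t * a) ⊙ x) by vring. lra. }
  assert (Hsmall : forall x e, 0 < e -> exists t, 0 < t /\ phi (w ⊕ t ⊙ x) - phi w <= t * (g x + e)).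
  { intros x e He. apply NNPP. intros Hn. assert (Hc : g x + e <= g x); [|lra].
    apply Hg2. intros t Ht. left. apply Rnot_le_lt. intros Hl. apply Hn. eauto. }
  (* difference quotients increase with the step *)
  assert (Hmono : forall x c s t, 0 < s <= t -> phi (w ⊕ t ⊙ x) - phi w <= t * c ->
            phi (w ⊕ s ⊙ x) - phi w <= s * c).
  { intros x c s t Hst H.
    assert (Hr : 0 <= s / t <= 1).
    { split; [apply Rmult_le_pos; [|left; apply Rinv_0_lt_compat]; lra|].
      apply (Rmult_le_reg_r t); [lra|]. unfold Rdiv. rewrite Rmult_assoc, Rinv_l; lra. }
    pose proof (Hconv (w ⊕ t ⊙ x) w (s / t) Hr) as H1.
    replace (s / t ⊙ (w ⊕ t ⊙ x) ⊕ (1 - s / t) ⊙ w) with (w ⊕ s ⊙ x) in H1 by (vfield; lra).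
    assert (H2 : s / t * (phi (w ⊕ t ⊙ x) - phi w) <= s / t * (t * c))
      by (apply Rmult_le_compat_l; lra).
    replace (s / t * (t * c)) with (s * c) in H2 by (field; lra). lra. }
  assert (Hgs : sublinear E g).
  { split.
    - intros x y. apply le_epsilon. intros e He.
      destruct (Hsmall x (e / 2) ltac:(lra)) as (s & Hs & H1).
      destruct (Hsmall y (e / 2) ltac:(lra)) as (t & Ht & H2).
      (* Monotonicity of the quotients allows a common step r; the point w + (r / 2) (x + y) is then
         the midpoint of w + r x and w + r y, and convexity applies. *)
      set (r := Rmin s t).
      assert (Hr : 0 < r) by now apply Rmin_glb_lt.
      apply (Hmono x _ r) in H1; [|split; [assumption|apply Rmin_l]].
      apply (Hmono y _ r) in H2; [|split; [assumption|apply Rmin_r]].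
      pose proof (Hg1 (x ⊕ y) (r / 2) ltac:(lra)) as H3.
      pose proof (Hconv (w ⊕ r ⊙ x) (w ⊕ r ⊙ y) (1 / 2) ltac:(lra)) as H4.
      replace (1 / 2 ⊙ (w ⊕ r ⊙ x) ⊕ (1 - 1 / 2) ⊙ (w ⊕ r ⊙ y))
        with (w ⊕ r / 2 ⊙ (x ⊕ y)) in H4 by (vlin; field).
      apply (Rmult_le_reg_l (r / 2)); lra.
    - intros a x Ha. destruct (Req_dec a 0) as [->|Ha0].
      + rewrite vscal_zero, Rmult_0_l. apply Rle_antisym.
        * rewrite <- snorm_zero. apply Hgn.
        * apply Hg2. intros t Ht. rewrite vscal_vzero, vadd_zero_r. lra.
      + apply Rle_antisym; [|apply Hsc; lra].
        assert (Hi : 0 < / a) by (apply Rinv_0_lt_compat; lra).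
        pose proof (Hsc (/ a) (a ⊙ x) Hi) as H.
        replace (/ a ⊙ (a ⊙ x)) with x in H by (vfield; lra).
        apply (Rmult_le_compat_l a) in H; [|lra].
        rewrite <- Rmult_assoc, Rinv_r, Rmult_1_l in H by lra. exact H. }
  destruct (hahn_banach_sublinear E g Hgs) as (f & Hfa & Hfs & Hfg).
  exists f. split; [split; [assumption|split; [assumption|]]|].
  - intros x. apply Rabs_le. split.
    + pose proof (Hfg (vopp E x)) as H. pose proof (Hgn (vopp E x)) as H'.
      rewrite snorm_opp in H'. rewrite vopp_scal, Hfs in H. rewrite vopp_scal in H'. lra.
    + specialize (Hfg x). specialize (Hgn x). lra.
  - intros x. pose proof (Hg1 (x ⊖ w) 1 ltac:(lra)) as H.
    replace (w ⊕ 1 ⊙ (x ⊖ w)) with x in H by vring.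
    specialize (Hfg (x ⊖ w)). lra.
Qed.

(** A subgradient of the seminorm at w does it: the subgradient inequality at the origin reads |w|
    <= f w. *)
Lemma norming_functional (w : E) : exists f, dual_ball E f /\ f w = snorm E w.
Proof.
  destruct (subgradient_exists (snorm E) w) as (f & Hf & Hw).
  - apply snorm_triangle.
  - intros x y t Ht. apply Rle_trans with (1 := snorm_triangle E _ _).
    rewrite !snorm_homog, !Rabs_pos_eq by lra. lra.
  - exists f. split; [assumption|].
    destruct Hf as (Ha & Hs & Hb).
    specialize (Hw (vzero E)). rewrite snorm_zero in Hw.
    replace (vzero E ⊖ w) with ((-1) ⊙ w) in Hw by vring. rewrite Hs in Hw.
    specialize (Hb w). pose proof (Rle_abs (f w)). lra.
Qed.

End NormFacts.

Lemma dual_ball_bounded (X : Banach) f : dual_ball X f -> bounded_linear_functional X f.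
Proof.
  intros (Ha & Hs & Hb). repeat split; auto. exists 1. intros x.
  rewrite Rmult_1_l. apply Hb.
Qed.

Lemma linear_zero (V : VecSpace) (f : V -> R) :
  (forall a x, f (a ⊙ x) = a * f x) -> f (vzero V) = 0.
Proof. intros H. rewrite <- (vscal_zero V (vzero V)), H. ring. Qed.

Lemma linear_sub (V : VecSpace) (f : V -> R) :
  (forall x y, f (x ⊕ y) = f x + f y) -> (forall a x, f (a ⊙ x) = a * f x) ->
  forall x y, f (x ⊖ y) = f x - f y.
Proof. intros Ha Hs x y. unfold vsub. rewrite Ha, vopp_scal, Hs. ring. Qed.

(** * Iterated quantifiers and limits along an ultrafilter *)

Record free_ultrafilter (U : (nat -> Prop) -> Prop) : Prop := {
  uf_and : forall P Q, U P -> U Q -> U (fun n => P n /\ Q n);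
  uf_mono : forall P Q : nat -> Prop, (forall n, P n -> Q n) -> U P -> U Q;
  uf_nonempty : forall P, U P -> exists n, P n;
  uf_dec : forall P : nat -> Prop, U P \/ U (fun n => ~ P n);
  uf_free : forall N, U (fun n => (N <= n)%nat)
}.

Lemma free_ultrafilter_exists : exists U, free_ultrafilter U.
Proof.
  set (F := fun P : nat -> Prop => exists N, forall n, (N <= n)%nat -> P n).
  assert (HF : filter.ProperFilter F).
  { split; [intros [N HN]; exact (HN N (le_n N))|]. split.
    - exists 0%nat. intros n _. exact I.
    - intros P Q [N HN] [N' HN']. exists (max N N'). intros n Hn.
      split; [apply HN|apply HN']; lia.
    - intros P Q HPQ [N HN]. exists N. intros n Hn. apply HPQ, HN, Hn. }
  destruct (@filter.ultraFilterLemma _ F HF) as (U & HU & HFU).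
  pose proof (@filter.filter_filter _ _ (@filter.ultra_proper _ _ HU)) as HUf.
  exists U. constructor.
  - intros P Q HP HQ. exact (@filter.filterI _ _ HUf P Q HP HQ).
  - intros P Q HPQ HP. exact (@filter.filterS _ _ HUf P Q HPQ HP).
  - intros P HP. apply NNPP. intros Hn.
    apply (@filter.filter_not_empty _ U (@filter.ultra_proper _ _ HU)).
    apply (@filter.filterS _ _ HUf P _); [|assumption].
    intros n Hp. apply Hn. now exists n.
  - intros P. exact (filter.in_ultra_setVsetC P HU).
  - intros N. apply HFU. exists N. auto.
Qed.

Section Ultrafilter.
Variable U : (nat -> Prop) -> Prop.
Hypothesis HU : free_ultrafilter U.

Lemma uf_all (P : nat -> Prop) : (forall n, P n) -> U P.
Proof. intros H. apply (uf_mono U HU _ _ (fun n _ => H n) (uf_free U HU 0)). Qed.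

Lemma uf_not (P : nat -> Prop) : ~ U P -> U (fun n => ~ P n).
Proof. destruct (uf_dec U HU P); tauto. Qed.

Lemma uf_forall_lt (R : nat -> nat -> Prop) (b : nat) :
  (forall i, (i < b)%nat -> U (R i)) -> U (fun n => forall i, (i < b)%nat -> R i n).
Proof.
  induction b as [|b IH]; intros H; [apply uf_all; intros; lia|].
  apply (uf_mono U HU (fun n => (forall i, (i < b)%nat -> R i n) /\ R b n)).
  - intros n [H1 H2] i Hi. destruct (Nat.eq_dec i b) as [->|]; [assumption|].
    apply H1. lia.
  - apply (uf_and U HU); auto.
Qed.

(** Only finitely many lists of length [d] have all entries below [b], and [U] is closed under
    finite intersections. *)
Lemma uf_forall_lists (R : list nat -> nat -> Prop) (b d : nat) :
  (forall t, U (R t)) ->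
  U (fun n => forall t, length t = d -> (forall a, In a t -> (a < b)%nat) -> R t n).
Proof.
  revert R. induction d as [|d IH]; intros R HR.
  - apply (uf_mono U HU (R [])); [|apply HR].
    intros n Hn [|a t] Ht; [auto|discriminate].
  - apply (uf_mono U HU (fun n => forall h, (h < b)%nat -> forall t, length t = d ->
      (forall a, In a t -> (a < b)%nat) -> R (h :: t) n)).
    + intros n Hn [|a t] Ht Hb; [discriminate|]. apply Hn.
      * apply Hb. now left.
      * now injection Ht.
      * intros c Hc. apply Hb. now right.
    + apply uf_forall_lt. intros h _. apply IH. auto.
Qed.

(** * Limits of real sequences along the ultrafilter *)

Definition ucv (y : nat -> R) (r : R) : Prop :=
  forall eps, 0 < eps -> U (fun n => Rabs (y n - r) < eps).

Lemma ucv_le (y z : nat -> R) (r s : R) :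
  ucv y r -> ucv z s -> U (fun n => y n <= z n) -> r <= s.
Proof.
  intros Hy Hz Hle. apply Rnot_lt_le. intros Hlt.
  assert (He : 0 < (r - s) / 2) by lra.
  destruct (uf_nonempty U HU _ (uf_and U HU _ _ Hle (uf_and U HU _ _ (Hy _ He) (Hz _ He))))
    as (n & H1 & H2 & H3).
  apply Rabs_def2 in H2, H3. lra.
Qed.

Lemma ucv_const (r : R) : ucv (fun _ => r) r.
Proof.
  intros eps He. apply uf_all. intros _. rewrite Rminus_diag. now rewrite Rabs_R0.
Qed.

Lemma ucv_unique (y : nat -> R) (r s : R) : ucv y r -> ucv y s -> r = s.
Proof.
  intros Hr Hs. apply Rle_antisym; apply (ucv_le y y); auto; apply uf_all; intros; lra.
Qed.

Lemma ucv_ext (y z : nat -> R) (r : R) : U (fun n => y n = z n) -> ucv y r -> ucv z r.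
Proof.
  intros He Hy eps Hp. apply (uf_mono U HU _ _ (fun n H => eq_ind _ (fun v => Rabs (v - r) < eps) (proj2 H) _ (proj1 H))
    (uf_and U HU _ _ He (Hy eps Hp))).
Qed.

Lemma ucv_add (y z : nat -> R) (r s : R) :
  ucv y r -> ucv z s -> ucv (fun n => y n + z n) (r + s).
Proof.
  intros Hy Hz eps He.
  apply (uf_mono U HU (fun n => Rabs (y n - r) < eps / 2 /\ Rabs (z n - s) < eps / 2)).
  - intros n [H1 H2]. replace (y n + z n - (r + s)) with ((y n - r) + (z n - s)) by ring.
    apply Rle_lt_trans with (1 := Rabs_triang _ _). lra.
  - apply (uf_and U HU); [apply Hy|apply Hz]; lra.
Qed.

Lemma ucv_scal (c : R) (y : nat -> R) (r : R) : ucv y r -> ucv (fun n => c * y n) (c * r).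
Proof.
  intros Hy eps He. pose proof (Rabs_pos c) as Hc.
  apply (uf_mono U HU (fun n => Rabs (y n - r) < eps / (Rabs c + 1))).
  - intros n H. rewrite <- Rmult_minus_distr_l, Rabs_mult.
    apply Rle_lt_trans with (Rabs c * (eps / (Rabs c + 1))).
    + apply Rmult_le_compat_l; lra.
    + apply (Rmult_lt_reg_r (Rabs c + 1)); [lra|].
      replace (Rabs c * (eps / (Rabs c + 1)) * (Rabs c + 1)) with (Rabs c * eps) by (field; lra).
      nra.
  - apply Hy. apply Rdiv_lt_0_compat; lra.
Qed.

(** The limit is the supremum of the levels that lie below almost all terms. *)
Lemma ucv_exists (y : nat -> R) (B : R) : (forall n, Rabs (y n) <= B) -> exists r, ucv y r.
Proof.
  intros HB.
  destruct (completeness (fun r => U (fun n => r <= y n))) as [r [H1 H2]].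
  - exists B. intros r Hr. destruct (uf_nonempty U HU _ Hr) as [n Hn].
    specialize (HB n). pose proof (Rle_abs (y n)). lra.
  - exists (- B). apply uf_all. intros n. specialize (HB n).
    pose proof (Rle_abs (- y n)). rewrite Rabs_Ropp in *. lra.
  - exists r. intros eps He.
    assert (Hlow : U (fun n => r - eps / 2 <= y n)).
    { apply NNPP. intros Hn. assert (Hc : r <= r - eps / 2); [|lra].
      apply H2. intros s Hs. apply Rnot_lt_le. intros Hlt. apply Hn.
      apply (uf_mono U HU _ _ (fun n H => Rle_trans _ _ _ (Rlt_le _ _ Hlt) H) Hs). }
    assert (Hup : U (fun n => ~ r + eps / 2 <= y n)).
    { apply uf_not. intros H. apply H1 in H. lra. }
    apply (uf_mono U HU (fun n => r - eps / 2 <= y n /\ ~ r + eps / 2 <= y n)).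
    + intros n [Ha Hb]. apply Rabs_def1; lra.
    + now apply (uf_and U HU).
Qed.

(* [n_1], ..., [n_d] are quantified along [U] one after the other, [n_1] outermost. *)
Fixpoint iter_uf (d : nat) (P : list nat -> Prop) (t : list nat) : Prop :=
  match d with
  | O => P t
  | S d' => U (fun n => iter_uf d' P (t ++ [n]))
  end.

Lemma iter_uf_mono d (P P' : list nat -> Prop) t :
  (forall u, length u = (length t + d)%nat -> P u -> P' u) -> iter_uf d P t -> iter_uf d P' t.
Proof.
  revert t. induction d as [|d IH]; simpl; intros t H; [apply H; lia|].
  apply (uf_mono U HU). intros n. apply IH. intros u Hu. apply H.
  rewrite Hu, length_app. simpl. lia.
Qed.

Lemma iter_uf_and d (P P' : list nat -> Prop) t :
  iter_uf d P t -> iter_uf d P' t -> iter_uf d (fun u => P u /\ P' u) t.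
Proof.
  revert t. induction d as [|d IH]; simpl; intros t H H'; [tauto|].
  apply (uf_mono U HU _ _ (fun n H => IH _ (proj1 H) (proj2 H))).
  now apply (uf_and U HU).
Qed.

Lemma iter_uf_all d (P : list nat -> Prop) t :
  (forall u, length u = (length t + d)%nat -> P u) -> iter_uf d P t.
Proof.
  revert t. induction d as [|d IH]; simpl; intros t H; [apply H; lia|].
  apply uf_all. intros n. apply IH. intros u Hu. apply H.
  rewrite Hu, length_app. simpl. lia.
Qed.

Lemma iter_uf_const d (P : Prop) t : iter_uf d (fun _ => P) t -> P.
Proof.
  revert t. induction d as [|d IH]; simpl; intros t H; [assumption|].
  destruct (uf_nonempty U HU _ H) as [n Hn]. now apply (IH (t ++ [n])).
Qed.

(** An ultrafilter commutes with negation, hence so does each nested quantifier. This turns the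
    failure of separation into a property of almost all plegma families. *)
Lemma iter_uf_not d (P : list nat -> Prop) t : ~ iter_uf d P t -> iter_uf d (fun u => ~ P u) t.
Proof.
  revert t. induction d as [|d IH]; simpl; intros t H; [assumption|].
  apply (uf_mono U HU (fun n => ~ iter_uf d P (t ++ [n]))); [auto|now apply uf_not].
Qed.

Lemma iter_uf_forall_In {A : Type} d (P : A -> list nat -> Prop) (l : list A) t :
  (forall a, In a l -> iter_uf d (P a) t) -> iter_uf d (fun u => forall a, In a l -> P a u) t.
Proof.
  induction l as [|a l IH]; intros H; [apply iter_uf_all; intros u _ b []|].
  apply (iter_uf_mono d (fun u => P a u /\ forall b, In b l -> P b u)).
  - intros u _ [H1 H2] b [<-|Hb]; auto.
  - apply iter_uf_and; [apply H; now left|]. apply IH. intros b Hb. apply H. now right.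
Qed.

Definition iter_ucv (d : nat) (phi : list nat -> R) (t : list nat) (L : R) : Prop :=
  forall eps, 0 < eps -> iter_uf d (fun u => Rabs (phi u - L) < eps) t.

(** For almost every n, almost all completions put [phi] close to both limits; the resulting
    inequality between [L] and [Ln n] no longer mentions the completion, so [iter_uf_const] releases
    it. *)
Lemma iter_ucv_step d phi t (L : R) (Ln : nat -> R) :
  iter_ucv (S d) phi t L -> (forall n, iter_ucv d phi (t ++ [n]) (Ln n)) -> ucv Ln L.
Proof.
  intros HL HLn eps He.
  apply (uf_mono U HU (fun n => iter_uf d (fun u => Rabs (phi u - L) < eps / 2) (t ++ [n]))).
  - intros n Hn. apply (iter_uf_const d _ (t ++ [n])).
    apply (iter_uf_mono d (fun u => Rabs (phi u - L) < eps / 2 /\ Rabs (phi u - Ln n) < eps / 2)).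
    + intros u _ [H1 H2]. apply Rabs_def2 in H1, H2. apply Rabs_def1; lra.
    + apply iter_uf_and; [assumption|apply HLn; lra].
  - apply (HL (eps / 2)). lra.
Qed.

Lemma iter_ucv_le d phi psi t L L' :
  iter_ucv d phi t L -> iter_ucv d psi t L' -> iter_uf d (fun u => phi u <= psi u) t -> L <= L'.
Proof.
  intros H H' Hle. apply Rnot_lt_le. intros Hlt.
  apply (iter_uf_const d False t).
  apply (iter_uf_mono d (fun u => phi u <= psi u /\ Rabs (phi u - L) < (L - L') / 2 /\
     Rabs (psi u - L') < (L - L') / 2)).
  - intros u _ (H1 & H2 & H3). apply Rabs_def2 in H2, H3. lra.
  - repeat apply iter_uf_and; [assumption|apply H; lra|apply H'; lra].
Qed.

Lemma iter_ucv_const d (c : R) t : iter_ucv d (fun _ => c) t c.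
Proof.
  intros eps He. apply iter_uf_all. intros u _. now rewrite Rminus_diag, Rabs_R0.
Qed.

Lemma iter_ucv_lin d (a b : R) phi psi t L L' :
  iter_ucv d phi t L -> iter_ucv d psi t L' -> iter_ucv d (fun u => a * phi u + b * psi u) t (a * L + b * L').
Proof.
  intros H H' eps He. pose proof (Rabs_pos a) as Ha. pose proof (Rabs_pos b) as Hb.
  set (e := eps / (Rabs a + Rabs b + 1)).
  assert (Hepos : 0 < e) by (apply Rdiv_lt_0_compat; lra).
  assert (Hee : e * (Rabs a + Rabs b + 1) = eps) by (unfold e; field; lra).
  apply (iter_uf_mono d (fun u => Rabs (phi u - L) < e /\ Rabs (psi u - L') < e)).
  - intros u _ (H1 & H2).
    replace (a * phi u + b * psi u - (a * L + b * L')) with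
      (a * (phi u - L) + b * (psi u - L')) by ring.
    apply Rle_lt_trans with (1 := Rabs_triang _ _). rewrite !Rabs_mult.
    pose proof (Rmult_le_compat_l _ _ _ Ha (Rlt_le _ _ H1)).
    pose proof (Rmult_le_compat_l _ _ _ Hb (Rlt_le _ _ H2)). nra.
  - now apply iter_uf_and; [apply H|apply H'].
Qed.

Lemma iter_ucv_exists d (phi : list nat -> R) (B : R) t :
  (forall u, Rabs (phi u) <= B) -> exists L, iter_ucv d phi t L.
Proof.
  intros HB. revert t. induction d as [|d IH]; intros t.
  - exists (phi t). intros eps He. simpl. now rewrite Rminus_diag, Rabs_R0.
  - set (Ln := fun n => proj1_sig (constructive_indefinite_description _ (IH (t ++ [n])))).
    assert (HLn : forall n, iter_ucv d phi (t ++ [n]) (Ln n))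
      by (intros n; apply (proj2_sig (constructive_indefinite_description _ (IH (t ++ [n]))))).
    destruct (ucv_exists Ln B) as [L HL].
    + intros n. apply Rabs_le. split.
      * apply (iter_ucv_le d (fun _ => - B) phi (t ++ [n])); [apply iter_ucv_const|apply HLn|].
        apply iter_uf_all. intros u _. specialize (HB u). pose proof (Rle_abs (- phi u)).
        rewrite Rabs_Ropp in *. lra.
      * apply (iter_ucv_le d phi (fun _ => B) (t ++ [n])); [apply HLn|apply iter_ucv_const|].
        apply iter_uf_all. intros u _. specialize (HB u). pose proof (Rle_abs (phi u)). lra.
    + exists L. intros eps He. simpl.
      apply (uf_mono U HU (fun n => Rabs (Ln n - L) < eps / 2)); [|apply HL; lra].
      intros n Hn. apply (iter_uf_mono d (fun u => Rabs (phi u - Ln n) < eps / 2)); [|apply HLn; lra].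
      intros u _ Hu. apply Rabs_def2 in Hn, Hu. apply Rabs_def1; lra.
Qed.

(** Its purpose is to exchange one entry of the prefix in a statement that does not look at that
    entry. *)
Lemma iter_uf_transport d (P P' : list nat -> Prop) t t' : length t = length t' ->
  (forall u, length u = d -> P (t ++ u) -> P' (t' ++ u)) -> iter_uf d P t -> iter_uf d P' t'.
Proof.
  revert t t'. induction d as [|d IH]; simpl; intros t t' Hl H HQ.
  - specialize (H [] eq_refl). rewrite !app_nil_r in H. auto.
  - apply (uf_mono U HU (fun n => iter_uf d P (t ++ [n]))); [|assumption]. intros n.
    apply IH; [rewrite !length_app; simpl; lia|].
    intros u Hu. rewrite <- !app_assoc. apply H. simpl. lia.
Qed.

(** * Diagonalization of countably many iterated statements *)

Section Diagonal.
Variables (P : nat -> nat -> list nat -> Prop) (D : nat -> nat).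
Hypothesis HP : forall i d, iter_uf d (P i d) [].

(* Any [n] that keeps every quantified statement true that is still open over a list of
   numbers below [b]; these are finitely many conditions, so [U]-almost all [n] qualify. *)
Definition diag_step (b n : nat) : Prop :=
  forall i, (i <= b)%nat -> forall d, (d <= D i)%nat -> forall r, (r < d)%nat ->
  forall t, length t = (d - S r)%nat -> (forall a, In a t -> (a < b)%nat) ->
  iter_uf (S r) (P i d) t -> iter_uf r (P i d) (t ++ [n]).

Lemma diag_step_next b : exists n, diag_step b n /\ (b <= n)%nat.
Proof.
  apply (uf_nonempty U HU). apply (uf_and U HU); [|apply (uf_free U HU)].
  unfold diag_step.
  apply (uf_mono U HU (fun n => forall i, (i < S b)%nat -> forall d, (d < S (D i))%nat ->
    forall r, (r < d)%nat -> forall t, length t = (d - S r)%nat ->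
    (forall a, In a t -> (a < b)%nat) -> iter_uf (S r) (P i d) t -> iter_uf r (P i d) (t ++ [n]))).
  { intros n H i Hi d Hd. apply H; lia. }
  apply uf_forall_lt. intros i _. apply uf_forall_lt. intros d _. apply uf_forall_lt. intros r _.
  apply uf_forall_lists. intros t.
  destruct (classic (iter_uf (S r) (P i d) t)) as [H|H].
  - simpl in H. apply (uf_mono U HU _ _ (fun n Hn _ => Hn) H).
  - apply uf_all. tauto.
Qed.

Definition next_elt (b : nat) : nat :=
  proj1_sig (constructive_indefinite_description _ (diag_step_next b)).

Fixpoint diag_enum (i : nat) : nat :=
  match i with
  | O => next_elt 0
  | S i' => next_elt (S (diag_enum i'))
  end.

(** Each element of M is chosen to be good for all prefixes made of smaller numbers, so the entries
    of [u] strip off the quantifiers one at a time. Both bounds keep the choice finite: condition i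
    is imposed only once the elements are large enough, and only for lengths up to [D i]. *)
Lemma diagonal_subset : exists M, infinite_enum M /\
  forall i d u, (d <= D i)%nat -> ksubset_of M d u -> (0 < d)%nat ->
    (M i <= nth 0 u 0)%nat -> P i d u.
Proof.
  assert (Hnext : forall b, diag_step b (next_elt b) /\ (b <= next_elt b)%nat).
  { intros b. apply (proj2_sig (constructive_indefinite_description _ (diag_step_next b))). }
  exists diag_enum.
  assert (Hinc : infinite_enum diag_enum).
  { intros i. simpl. destruct (Hnext (S (diag_enum i))). lia. }
  split; [assumption|].
  assert (Hlt : forall i j, (i < j)%nat -> (diag_enum i < diag_enum j)%nat).
  { intros i j Hij. induction Hij as [|j Hij IH]; [apply Hinc|].
    apply Nat.lt_trans with (1 := IH), Hinc. }
  assert (Hge : forall i, (i <= diag_enum i)%nat).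
  { induction i as [|i IH]; [lia|]. specialize (Hinc i). lia. }
  intros i d u Hd (Hlen & Hsi & HM) Hd0 Hstart.
  assert (Hmon : forall p q, (p < q)%nat -> (q < d)%nat -> (nth p u 0 < nth q u 0)%nat).
  { intros p q Hpq. induction Hpq as [|q Hpq IH]; intros Hq.
    - apply Hsi. lia.
    - apply Nat.lt_trans with (1 := IH ltac:(lia)). apply Hsi. lia. }
  (* Invariant: after q entries of [u] the statement holds with its remaining d - q quantifiers. *)
  assert (Hpre : forall q, (q <= d)%nat -> iter_uf (d - q) (P i d) (firstn q u)).
  { induction q as [|q IH]; intros Hq.
    - rewrite Nat.sub_0_r. apply HP.
    - destruct (HM q ltac:(lia)) as [j Hj].
      assert (Hfs : firstn (S q) u = firstn q u ++ [diag_enum j]).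
      { rewrite <- Hj. clear - Hlen Hq. revert d u Hlen Hq. induction q as [|q IH]; intros d [|a u] Hlen Hq; simpl in *; try lia; [reflexivity|].
        f_equal. apply (IH (pred d)); lia. }
      rewrite Hfs.
      assert (Hfl : length (firstn q u) = q) by (rewrite length_firstn; lia).
      assert (Hin : forall a, In a (firstn q u) -> (a < diag_enum j)%nat).
      { intros a Ha. apply (In_nth _ _ 0%nat) in Ha. destruct Ha as (p & Hp & <-).
        rewrite Hfl in Hp. rewrite nth_firstn. destruct (Nat.ltb_spec p q); [|lia].
        rewrite <- Hj. apply Hmon; lia. }
      (* Condition i was already imposed when the element M j was chosen: otherwise M j < M i <=
         u(0) <= u(q) = M j. *)
      assert (Hij : (i <= j)%nat).
      { apply Nat.nlt_ge. intros Hji. apply Hlt in Hji. rewrite <- Hj in Hji.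
        destruct (Nat.eq_dec q 0) as [->|Hq0]; [lia|].
        pose proof (Hmon 0%nat q ltac:(lia) ltac:(lia)). lia. }
      specialize (IH ltac:(lia)). replace (d - q)%nat with (S (d - S q)) in IH by lia.
      (* The first element of M was chosen with bound 0, which covers only the empty prefix; a
         nonempty prefix would contain an element of M below the first one. *)
      destruct j as [|j]; simpl.
      + destruct q as [|q].
        * apply (proj1 (Hnext 0%nat)); try lia; [intros a []|assumption].
        * exfalso. destruct (HM 0%nat ltac:(lia)) as [j' Hj'].
          pose proof (Hmon 0%nat (S q) ltac:(lia) ltac:(lia)) as H. rewrite Hj, Hj' in H.
          destruct j' as [|j']; [lia|]. specialize (Hlt 0%nat (S j') ltac:(lia)). lia.
      + apply (proj1 (Hnext (S (diag_enum j)))); try lia.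
        * specialize (Hge j). lia.
        * intros a Ha. apply (In_nth _ _ 0%nat) in Ha. destruct Ha as (p & Hp & <-).
          rewrite Hfl in Hp. rewrite nth_firstn. destruct (Nat.ltb_spec p q); [|lia].
          destruct (HM p ltac:(lia)) as [j' Hj'].
          pose proof (Hmon p q ltac:(lia) ltac:(lia)) as H'. rewrite Hj, Hj' in *.
          destruct (Nat.le_gt_cases j' j) as [Hle|Hgt].
          -- destruct (Nat.eq_dec j' j) as [->|]; [lia|].
             specialize (Hlt j' j ltac:(lia)). lia.
          -- destruct (Nat.eq_dec j' (S j)) as [->|]; [lia|].
             specialize (Hlt (S j) j' ltac:(lia)). lia.
        * assumption. }
  specialize (Hpre d (le_n d)). rewrite Nat.sub_diag in Hpre.
  rewrite firstn_all2 in Hpre by lia. exact Hpre.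
Qed.

End Diagonal.
End Ultrafilter.

(** * Weakly compact sets *)

Section WeakCompactness.
Variable X : Banach.
Variable U : (nat -> Prop) -> Prop.
Hypothesis HU : free_ultrafilter U.

Lemma weakly_open_strip (f : X -> R) (c eps : R) :
  bounded_linear_functional X f -> weakly_open X (fun y => Rabs (f y - c) < eps).
Proof.
  intros Hf x Hx. exists [f], (eps - Rabs (f x - c)). split; [lra|]. split.
  - intros g [<-|[]]. assumption.
  - intros y Hy. specialize (Hy f (or_introl eq_refl)).
    replace (f y - c) with ((f y - f x) + (f x - c)) by ring.
    apply Rle_lt_trans with (1 := Rabs_triang _ _). lra.
Qed.

Lemma weakly_compact_functional_bounded (K : X -> Prop) (f : X -> R) :
  weakly_compact X K -> bounded_linear_functional X f ->
  exists B, forall x, K x -> Rabs (f x) <= B.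
Proof.
  intros HK Hf.
  destruct (HK nat (fun n y => Rabs (f y - 0) < INR n)) as [F HF].
  - intros n. now apply weakly_open_strip.
  - intros x _. destruct (INR_unbounded (Rabs (f x - 0))) as [n Hn]. now exists n.
  - exists (INR (list_max F)). intros x Hx. destruct (HF x Hx) as (n & Hn & Hlt).
    rewrite Rminus_0_r in Hlt. apply Rlt_le, Rlt_le_trans with (1 := Hlt).
    apply le_INR. pose proof (proj1 (list_max_le F _) (le_n _)) as H.
    rewrite Forall_forall in H. auto.
Qed.

(* Gliding hump: [f = sum_n s_n 3^-n g_n], with [g_n] norming a very long [y_n] and the
   signs [s_n] chosen so that the n-th hump is not cancelled by the previous ones. *)
Lemma weakly_compact_norm_bounded (K : X -> Prop) :
  weakly_compact X K -> exists B, forall x, K x -> snorm X x <= B.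
Proof.
  intros HK. apply NNPP. intros Hn.
  (* The later humps contribute at most half of 3^-n |y_n|, so |f y_n| >= 3^-n |y_n| / 2, and the
     factor 2 n 3^n makes this exceed n. *)
  assert (Hex : forall n, exists y, K y /\ 2 * INR n * 3 ^ n < snorm X y).
  { intros n. apply NNPP. intros H. apply Hn. exists (2 * INR n * 3 ^ n). intros x Hx.
    apply Rnot_lt_le. intros Hlt. apply H. eauto. }
  destruct (choice _ Hex) as [y Hy]. clear Hex Hn.
  destruct (choice _ (fun n => norming_functional X (y n))) as [g Hg].
  assert (Hsgn : forall n (F : X -> R), exists s,
    Rabs s = 1 /\ (/ 3) ^ n * snorm X (y n) <= Rabs (F (y n) + s * (/ 3) ^ n * g n (y n))).
  { intros n F. rewrite (proj2 (Hg n)).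
    assert (H3 : 0 < (/ 3) ^ n) by (apply pow_lt; lra).
    pose proof (snorm_nonneg X (y n)) as H0.
    pose proof (Rmult_le_pos _ _ (Rlt_le _ _ H3) H0) as H.
    destruct (Rle_lt_dec 0 (F (y n))) as [Hp|Hp].
    - exists 1. rewrite Rabs_R1, Rmult_1_l. split; [reflexivity|].
      rewrite Rabs_pos_eq; lra.
    - exists (-1). split; [rewrite Rabs_left; lra|]. rewrite Rabs_left1; lra. }
  set (sg := fun n F => proj1_sig (constructive_indefinite_description _ (Hsgn n F))).
  assert (Hs : forall n F, Rabs (sg n F) = 1 /\
     (/ 3) ^ n * snorm X (y n) <= Rabs (F (y n) + sg n F * (/ 3) ^ n * g n (y n))).
  { intros n F. apply (proj2_sig (constructive_indefinite_description _ (Hsgn n F))). }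
  clearbody sg.
  set (F := fix F n := match n with O => fun _ => 0
    | S n' => fun x => F n' x + sg n' (F n') * (/ 3) ^ n' * g n' x end).
  assert (Fadd : forall n a b, F n (a ⊕ b) = F n a + F n b).
  { induction n as [|n IH]; intros a b; simpl; [ring|]. rewrite IH.
    rewrite (proj1 (proj1 (Hg n))). ring. }
  assert (Fsc : forall n a b, F n (a ⊙ b) = a * F n b).
  { induction n as [|n IH]; intros a b; simpl; [ring|]. rewrite IH.
    rewrite (proj1 (proj2 (proj1 (Hg n)))). ring. }
  assert (Hstep : forall n x, Rabs (F (S n) x - F n x) <= (/ 3) ^ n * snorm X x).
  { intros n x. simpl. replace (F n x + sg n (F n) * (/ 3) ^ n * g n x - F n x)
      with (sg n (F n) * ((/ 3) ^ n * g n x)) by ring.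
    rewrite Rabs_mult, (proj1 (Hs n (F n))), Rmult_1_l, Rabs_mult.
    rewrite (Rabs_pos_eq ((/ 3) ^ n)) by (apply pow_le; lra).
    apply Rmult_le_compat_l; [apply pow_le; lra|]. apply (proj2 (proj2 (proj1 (Hg n)))). }
  (* The exact geometric sum is kept, since the bound with 3^-n alone would not pass through the
     induction. *)
  assert (Htail : forall n i x, Rabs (F (i + n)%nat x - F n x) <=
     3 / 2 * ((/ 3) ^ n - (/ 3) ^ (i + n)) * snorm X x).
  { intros n i x. induction i as [|i IH].
    - simpl. rewrite Rminus_diag, Rabs_R0. lra.
    - specialize (Hstep (i + n)%nat x). change (S i + n)%nat with (S (i + n)).
      replace (F (S (i + n)) x - F n x) with
        ((F (S (i + n)) x - F (i + n)%nat x) + (F (i + n)%nat x - F n x)) by ring.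
      apply Rle_trans with (1 := Rabs_triang _ _). rewrite <- tech_pow_Rmult. lra. }
  assert (Htail' : forall n m x, (n <= m)%nat ->
     Rabs (F m x - F n x) <= 3 / 2 * (/ 3) ^ n * snorm X x).
  { intros n m x Hnm. specialize (Htail n (m - n)%nat x).
    rewrite Nat.sub_add in Htail by assumption.
    apply Rle_trans with (1 := Htail). apply Rmult_le_compat_r; [apply snorm_nonneg|].
    assert (0 < (/ 3) ^ m) by (apply pow_lt; lra). lra. }
  assert (Hlim : forall x, exists r, ucv U (fun n => F n x) r).
  { intros x. apply (ucv_exists U HU _ (3 / 2 * snorm X x)). intros n.
    specialize (Htail' 0%nat n x ltac:(lia)). simpl in Htail'.
    rewrite Rminus_0_r in Htail'. lra. }
  destruct (choice _ Hlim) as [f Hf].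
  assert (Hclose : forall n x, Rabs (f x - F n x) <= 3 / 2 * (/ 3) ^ n * snorm X x).
  { intros n x. pose proof (fun m H => Htail' n m x H) as H. apply Rabs_le. split.
    - apply Rminus_le. apply Rle_trans with (F n x - 3 / 2 * (/ 3) ^ n * snorm X x - f x); [lra|].
      apply Rle_minus. apply (ucv_le U HU (fun _ => F n x - 3 / 2 * (/ 3) ^ n * snorm X x) (fun m => F m x)).
      + now apply ucv_const.
      + apply Hf.
        apply (uf_mono U HU (fun m => (n <= m)%nat)); [|apply (uf_free U HU)].
        intros m Hm. specialize (H m Hm). pose proof (Rle_abs (- (F m x - F n x))).
        rewrite Rabs_Ropp in *. lra.
    - apply Rplus_le_reg_r with (F n x). ring_simplify.
      apply Rle_trans with (F n x + 3 / 2 * (/ 3) ^ n * snorm X x); [|lra].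
      apply (ucv_le U HU (fun m => F m x) (fun _ => F n x + 3 / 2 * (/ 3) ^ n * snorm X x)).
      + apply Hf.
      + now apply ucv_const.
      + apply (uf_mono U HU (fun m => (n <= m)%nat)); [|apply (uf_free U HU)].
        intros m Hm. specialize (H m Hm). pose proof (Rle_abs (F m x - F n x)). lra. }
  assert (Hblf : bounded_linear_functional X f).
  { repeat split.
    - intros a b. apply (ucv_unique U HU (fun n => F n (a ⊕ b))); [apply Hf|].
      apply (ucv_ext U HU (fun n => F n a + F n b)); [|now apply ucv_add].
      apply (uf_all U HU). intros n. now rewrite Fadd.
    - intros a b. apply (ucv_unique U HU (fun n => F n (a ⊙ b))); [apply Hf|].
      apply (ucv_ext U HU (fun n => a * F n b)); [|now apply ucv_scal].
      apply (uf_all U HU). intros n. now rewrite Fsc.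
    - exists (3 / 2). intros x. specialize (Hclose 0%nat x). simpl in Hclose.
      rewrite Rminus_0_r in Hclose. lra. }
  destruct (weakly_compact_functional_bounded K f HK Hblf) as [B HB].
  destruct (INR_unbounded B) as [n HnB].
  destruct (Hy n) as [HKy Hlong]. specialize (HB _ HKy).
  pose proof (Hclose (S n) (y n)) as H1. pose proof (proj2 (Hs n (F n))) as H2.
  change (F n (y n) + sg n (F n) * (/ 3) ^ n * g n (y n)) with (F (S n) (y n)) in H2.
  rewrite <- tech_pow_Rmult in H1.
  assert (H3 : Rabs (F (S n) (y n)) <= Rabs (f (y n)) + Rabs (f (y n) - F (S n) (y n))).
  { pose proof (Rabs_triang (f (y n)) (- (f (y n) - F (S n) (y n)))) as H.
    rewrite Rabs_Ropp in H.
    now replace (f (y n) + - (f (y n) - F (S n) (y n))) with (F (S n) (y n)) in H by ring. }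
  assert (H4 : (/ 3) ^ n * (2 * INR n * 3 ^ n) < (/ 3) ^ n * snorm X (y n)).
  { apply Rmult_lt_compat_l; [apply pow_lt; lra|assumption]. }
  replace ((/ 3) ^ n * (2 * INR n * 3 ^ n)) with (2 * INR n * ((/ 3) ^ n * 3 ^ n)) in H4 by ring.
  rewrite <- Rpow_mult_distr in H4. replace (/ 3 * 3) with 1 in H4 by field.
  rewrite pow1 in H4. lra.
Qed.

Definition weak_ucv (y : nat -> X) (w : X) : Prop :=
  forall f, bounded_linear_functional X f -> ucv U (fun n => f (y n)) (f w).

(** If no point of K were a limit, each would lie in a strip |f - c| < eps that almost no [y n]
    meets. The type [I] indexes all strips of this kind; finitely many of them cover K, yet some
    [y n] avoids all of these. *)
Lemma weak_ulimit_exists (K : X -> Prop) (y : nat -> X) :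
  weakly_compact X K -> (forall n, K (y n)) -> exists w, K w /\ weak_ucv y w.
Proof.
  intros HK Hy. apply NNPP. intros Hn.
  set (I := {p : (X -> R) * R * R | bounded_linear_functional X (fst (fst p)) /\
    ~ U (fun n => Rabs (fst (fst p) (y n) - snd (fst p)) < snd p)}).
  destruct (HK I (fun p x => Rabs (fst (fst (proj1_sig p)) x - snd (fst (proj1_sig p))) < snd (proj1_sig p))) as [F HF].
  - intros [[[f c] eps] [Hf HUn]]. now apply weakly_open_strip.
  - intros x Hx. apply NNPP. intros Hc. apply Hn. exists x. split; [assumption|].
    intros f Hf eps He. apply NNPP. intros HUn. apply Hc.
    exists (exist _ (f, f x, eps) (conj Hf HUn)). simpl.
    now rewrite Rminus_diag, Rabs_R0.
  - assert (Hall : U (fun n => forall p, In p F -> ~ (Rabs (fst (fst (proj1_sig p)) (y n) - snd (fst (proj1_sig p))) < snd (proj1_sig p)))).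
    { clear HF. induction F as [|p F IH]; [apply (uf_all U HU); intros n p []|].
      apply (uf_mono U HU _ _ (fun n H q Hq => match Hq with
         | or_introl e => eq_ind p (fun q => ~ (Rabs (fst (fst (proj1_sig q)) (y n) - snd (fst (proj1_sig q))) < snd (proj1_sig q))) (proj1 H) q e
         | or_intror i => proj2 H q i end)).
      apply (uf_and U HU); [|exact IH]. apply (uf_not U HU). apply (proj2 (proj2_sig p)). }
    destruct (uf_nonempty U HU _ Hall) as [n Hnn].
    destruct (HF (y n) (Hy n)) as (p & Hp & Hlt). exact (Hnn p Hp Hlt).
Qed.

(** A subgradient at [w] is an affine minorant of [phi] that touches it at [w], and affine functions
    pass to the weak limit. *)
Lemma weak_lower_semicontinuous (phi : X -> R) (y : nat -> X) (w : X) (r : R) :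
  (forall a b, phi (a ⊕ b) <= phi a + snorm X b) ->
  (forall a b t, 0 <= t <= 1 ->
     phi (t ⊙ a ⊕ (1 - t) ⊙ b) <= t * phi a + (1 - t) * phi b) ->
  weak_ucv y w -> ucv U (fun n => phi (y n)) r -> phi w <= r.
Proof.
  intros Hlip Hconv Hw Hr.
  destruct (subgradient_exists X phi w Hlip Hconv) as (f & Hf & Hsub).
  pose proof Hf as (Ha & Hs & _).
  assert (H : phi w + f w <= r + f w); [|lra].
  apply (ucv_le U HU (fun n => phi w + f (y n)) (fun n => phi (y n) + f w)).
  - apply (ucv_add U HU); [now apply ucv_const|]. apply Hw. now apply dual_ball_bounded.
  - apply (ucv_add U HU); [assumption|now apply ucv_const].
  - apply (uf_all U HU). intros n. specialize (Hsub (y n)).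
    rewrite (linear_sub _ f Ha Hs) in Hsub. lra.
Qed.

Lemma weak_ucv_lincomb (a : nat -> R) (y : nat -> nat -> X) (w : nat -> X) (m : nat) :
  (forall j, (j < m)%nat -> weak_ucv (fun n => y n j) (w j)) ->
  weak_ucv (fun n => lincomb a (y n) m) (lincomb a w m).
Proof.
  intros H f Hf. pose proof Hf as (Ha & Hs & _).
  induction m as [|m IH]; simpl; [now apply ucv_const|].
  rewrite Ha, Hs.
  apply (ucv_ext U HU (fun n => f (lincomb a (y n) m) + a m * f (y n m))).
  - apply (uf_all U HU). intros n. now rewrite Ha, Hs.
  - apply (ucv_add U HU); [apply IH; auto|]. apply (ucv_scal U HU). apply H; auto.
Qed.

End WeakCompactness.

(** * Averages over [k]-subsets *)

(** The recursion is that of [ksubsets]. It yields 0 for n < k, where the factorial quotient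
    [Binomial.C] does not, hence the restriction in [bin_C]. *)
Fixpoint bin (n k : nat) : nat :=
  match k, n with
  | O, _ => 1
  | S _, O => 0
  | S k', S n' => bin n' k' + bin n' k
  end.

Lemma bin_0_r n : bin n 0 = 1%nat.
Proof. now destruct n. Qed.

Lemma bin_overflow n k : (n < k)%nat -> bin n k = 0%nat.
Proof.
  revert k. induction n as [|n IH]; intros [|k] H; simpl; try lia.
  rewrite !IH; lia.
Qed.

Lemma bin_pos n k : (k <= n)%nat -> (0 < bin n k)%nat.
Proof.
  revert k. induction n as [|n IH]; intros [|k] H; simpl; try lia.
  specialize (IH k). lia.
Qed.

Lemma bin_C n k : (k <= n)%nat -> INR (bin n k) = Binomial.C n k.
Proof.
  revert k. induction n as [|n IH]; intros k H.
  - replace k with 0%nat by lia. simpl. unfold Binomial.C. simpl. field.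
  - destruct k as [|k].
    + unfold Binomial.C. rewrite Nat.sub_0_r.
      change (INR (bin (S n) 0)) with 1. change (INR (Factorial.fact 0)) with 1.
      field. apply INR_fact_neq_0.
    + simpl bin. rewrite plus_INR, IH by lia.
      destruct (Nat.eq_dec k n) as [->|Hk].
      * rewrite bin_overflow by lia. unfold Binomial.C. rewrite !Nat.sub_diag.
        change (INR (Factorial.fact 0)) with 1. change (INR 0) with 0. field. split; apply INR_fact_neq_0.
      * rewrite IH by lia. apply pascal. lia.
Qed.

(** This is (k + 1) C(n, k + 1) = (n - k) C(n, k) without truncated subtraction. It makes boundary
    terms of order C(n, k) negligible against C(n, k + 1). *)
Lemma bin_absorb n k : (S k * bin n (S k) + k * bin n k = n * bin n k)%nat.
Proof.
  revert k. induction n as [|n IH]; intros k; [destruct k; simpl; lia|].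
  destruct k as [|k].
  - specialize (IH 0%nat). rewrite !bin_0_r in *. simpl bin. rewrite !bin_0_r. nia.
  - pose proof (IH (S k)) as H1. pose proof (IH k) as H2. simpl bin. nia.
Qed.

Lemma length_ksubsets k l : length (ksubsets k l) = bin (length l) k.
Proof.
  revert k. induction l as [|h t IH]; intros [|k]; simpl; try reflexivity.
  now rewrite length_app, length_map, !IH.
Qed.

Lemma ksubsets_map (g : nat -> nat) k l :
  ksubsets k (map g l) = map (map g) (ksubsets k l).
Proof.
  revert k. induction l as [|h t IH]; intros [|k]; simpl; try reflexivity.
  rewrite map_app, !map_map, !IH, map_map. reflexivity.
Qed.

Definition rsum (l : list R) : R := fold_right Rplus 0 l.

Lemma rsum_app l l' : rsum (l ++ l') = rsum l + rsum l'.
Proof. induction l as [|a l IH]; simpl; [ring|]. unfold rsum in *. simpl. rewrite IH. ring. Qed.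

Lemma rsum_le {A : Type} (f g : A -> R) l :
  (forall a, In a l -> f a <= g a) -> rsum (map f l) <= rsum (map g l).
Proof.
  induction l as [|a l IH]; intros H; unfold rsum in *; simpl; [lra|].
  apply Rplus_le_compat; [apply H; now left|apply IH; intros; apply H; now right].
Qed.

Lemma rsum_plus {A : Type} (f g : A -> R) l :
  rsum (map (fun a => f a + g a) l) = rsum (map f l) + rsum (map g l).
Proof. induction l as [|a l IH]; unfold rsum in *; simpl; [ring|]. rewrite IH. ring. Qed.

Lemma rsum_scal {A : Type} c (f : A -> R) l :
  rsum (map (fun a => c * f a) l) = c * rsum (map f l).
Proof. induction l as [|a l IH]; unfold rsum in *; simpl; [ring|]. rewrite IH. ring. Qed.

Lemma rsum_const {A : Type} c (l : list A) : rsum (map (fun _ => c) l) = INR (length l) * c.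
Proof.
  induction l as [|a l IH]; unfold rsum in *; [simpl; ring|].
  simpl map. simpl fold_right. simpl length. rewrite IH, S_INR. ring.
Qed.

Lemma rsum_exchange {A B : Type} (f : A -> B -> R) l l' :
  rsum (map (fun a => rsum (map (f a) l')) l) = rsum (map (fun b => rsum (map (fun a => f a b) l)) l').
Proof.
  induction l as [|a l IH].
  - simpl. change (rsum (map (fun b => rsum [])  l')) with (rsum (map (fun _ : B => 0) l')).
    rewrite rsum_const. unfold rsum. simpl. ring.
  - change (rsum (map (f a) l') + rsum (map (fun a => rsum (map (f a) l')) l) =
      rsum (map (fun b => f a b + rsum (map (fun a => f a b) l)) l')).
    now rewrite IH, rsum_plus.
Qed.

(** * Translation of sums over k-subsets, and sets with large gaps *)

Definition ksum (y : list nat -> R) (k : nat) (l : list nat) : R := rsum (map y (ksubsets k l)).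

Lemma ksum_cons y k h t :
  ksum y (S k) (h :: t) = ksum (fun p => y (h :: p)) k t + ksum y (S k) t.
Proof. unfold ksum. simpl. now rewrite map_app, rsum_app, map_map. Qed.

Lemma ksum_le y z k l :
  (forall p, In p (ksubsets k l) -> y p <= z p) -> ksum y k l <= ksum z k l.
Proof. apply rsum_le. Qed.

Lemma ksum_const c k l : ksum (fun _ => c) k l = INR (bin (length l) k) * c.
Proof. unfold ksum. now rewrite rsum_const, length_ksubsets. Qed.

Lemma ksum_abs_le y B k l : (forall p, Rabs (y p) <= B) ->
  Rabs (ksum y k l) <= INR (bin (length l) k) * B.
Proof.
  intros H. rewrite <- ksum_const. apply Rabs_le. split.
  - apply Rle_trans with (ksum (fun p => - B) k l); [right; rewrite !ksum_const; ring|].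
    apply ksum_le. intros p _. specialize (H p). pose proof (Rle_abs (- y p)).
    rewrite Rabs_Ropp in *. lra.
  - apply ksum_le. intros p _. specialize (H p). pose proof (Rle_abs (y p)). lra.
Qed.

Lemma ksum_drop_first y B k h t : (forall p, Rabs (y p) <= B) ->
  Rabs (ksum y (S k) (h :: t) - ksum y (S k) t) <= INR (bin (length t) k) * B.
Proof.
  intros H. rewrite ksum_cons. replace (_ + _ - _) with (ksum (fun p => y (h :: p)) k t) by ring.
  apply ksum_abs_le. auto.
Qed.

Lemma ksum_drop_last y B k t z : (forall p, Rabs (y p) <= B) ->
  Rabs (ksum y (S k) (t ++ [z]) - ksum y (S k) t) <= INR (bin (length t) k) * B.
Proof.
  revert y k. induction t as [|h t IH]; intros y k H.
  - apply (ksum_drop_first y B k z []). assumption.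
  - simpl app. rewrite !ksum_cons.
    replace (_ + _ - _) with
      ((ksum (fun p => y (h :: p)) k (t ++ [z]) - ksum (fun p => y (h :: p)) k t) +
       (ksum y (S k) (t ++ [z]) - ksum y (S k) t)) by ring.
    apply Rle_trans with (1 := Rabs_triang _ _).
    pose proof (IH y k H) as H1. destruct k as [|k].
    + unfold ksum at 1 2. destruct (t ++ [z]), t; simpl ksubsets; rewrite Rminus_diag, Rabs_R0;
        rewrite bin_0_r in *; lra.
    + pose proof (IH (fun p => y (h :: p)) k (fun p => H _)) as H2.
      simpl length. simpl bin. rewrite plus_INR. lra.
Qed.

(** Moving the interval by one step adds a last point and drops the first one; each change affects
    only the C(n, k) sets that contain that point. *)
Lemma ksum_shift y B k h n : (forall p, Rabs (y p) <= B) ->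
  Rabs (ksum y (S k) (seq h n) - ksum y (S k) (seq 0 n)) <= INR h * (2 * INR (bin n k) * B).
Proof.
  intros H. induction h as [|h IH]; [rewrite Rminus_diag, Rabs_R0; simpl; lra|].
  pose proof (ksum_drop_first y B k h (seq (S h) n) H) as H1.
  pose proof (ksum_drop_last y B k (seq h n) (h + n)%nat H) as H2.
  rewrite <- seq_S in H2. change (h :: seq (S h) n) with (seq h (S n)) in H1.
  rewrite length_seq in H1, H2. rewrite S_INR.
  replace (ksum y (S k) (seq (S h) n) - ksum y (S k) (seq 0 n)) with
    (- (ksum y (S k) (seq h (S n)) - ksum y (S k) (seq (S h) n)) +
     ((ksum y (S k) (seq h (S n)) - ksum y (S k) (seq h n)) +
     (ksum y (S k) (seq h n) - ksum y (S k) (seq 0 n)))) by ring.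
  apply Rle_trans with (1 := Rabs_triang _ _). rewrite Rabs_Ropp.
  pose proof (Rabs_triang (ksum y (S k) (seq h (S n)) - ksum y (S k) (seq h n))
     (ksum y (S k) (seq h n) - ksum y (S k) (seq 0 n))). lra.
Qed.

(** Gaps of at least [W] are what lets the translates by less than [W] interleave; [lo] pushes them
    far enough out for the diagonal argument to apply. *)
Fixpoint spaced (W lo : nat) (p : list nat) : bool :=
  match p with
  | [] => true
  | a :: p' => Nat.leb lo a && spaced W (a + W) p'
  end.

Definition gap (W lo : nat) (p : list nat) : R := if spaced W lo p then 0 else 1.

Lemma gap_le_1 W lo p : Rabs (gap W lo p) <= 1.
Proof. unfold gap. destruct spaced; [rewrite Rabs_R0|rewrite Rabs_R1]; lra. Qed.

(** An exceptional set has its least element among the lo - a points below [lo], or one of its k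
    gaps is shorter than [W]. That leaves at most k W + (lo - a) choices for one element in terms of
    the k others. *)
Lemma ksum_gap W lo k a n : (1 <= W)%nat ->
  ksum (gap W lo) (S k) (seq a n) <= INR (k * W + (lo - a)) * INR (bin n k).
Proof.
  intros HW. rewrite <- mult_INR. revert lo k a.
  induction n as [|n IH]; intros lo k a; [apply pos_INR|].
  change (seq a (S n)) with (a :: seq (S a) n). rewrite ksum_cons.
  pose proof (IH lo k (S a)) as H1. destruct (Nat.le_gt_cases lo a) as [Hlo|Hlo].
  - replace (lo - S a)%nat with 0%nat in H1 by lia. replace (lo - a)%nat with 0%nat by lia.
    (* Once a is the least element, the rest must be spaced from a + W on; the induction hypothesis
       with [lo] = a + W costs at most one further [W]. *)
    assert (H2 : ksum (fun p => gap W lo (a :: p)) k (seq (S a) n) <=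
       INR (match k with O => 0 | S k' => k * W * bin n k' end)).
    { apply Rle_trans with (ksum (gap W (a + W)) k (seq (S a) n)).
      - apply ksum_le. intros p _. unfold gap. simpl.
        destruct (Nat.leb_spec lo a); [simpl; lra|lia].
      - destruct k as [|k].
        + unfold ksum, gap. destruct n; simpl; lra.
        + apply Rle_trans with (1 := IH (a + W)%nat k (S a)).
          apply le_INR, Nat.mul_le_mono_r. rewrite Nat.mul_succ_l. lia. }
    apply Rle_trans with (1 := Rplus_le_compat _ _ _ _ H2 H1).
    rewrite <- plus_INR. apply le_INR. destruct k as [|k]; simpl bin; nia.
  - pose proof (ksum_abs_le (fun p => gap W lo (a :: p)) 1 k (seq (S a) n) (fun p => gap_le_1 _ _ _)) as H2.
    pose proof (Rle_abs (ksum (fun p => gap W lo (a :: p)) k (seq (S a) n))).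
    rewrite length_seq, Rmult_1_r in H2.
    apply Rle_trans with (INR (bin n k) + INR ((k * W + (lo - S a)) * bin n k)); [lra|].
    rewrite <- plus_INR. apply le_INR.
    assert (bin n k <= bin (S n) k)%nat by (destruct k; simpl; rewrite ?bin_0_r; lia).
    replace (k * W + (lo - a))%nat with (S (k * W + (lo - S a))) by lia.
    now apply (Nat.mul_le_mono_l _ _ (S (k * W + (lo - S a)))).
Qed.

Lemma map_plus_seq h n : map (Nat.add h) (seq 0 n) = seq h n.
Proof.
  revert h. induction n as [|n IH]; intros h; [reflexivity|].
  rewrite !seq_S, map_app, IH. simpl. reflexivity.
Qed.

Lemma ksum_translate y h k n :
  ksum (fun p => y (map (Nat.add h) p)) k (seq 0 n) = ksum y k (seq h n).
Proof. unfold ksum. now rewrite <- (map_plus_seq h n), ksubsets_map, map_map. Qed.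

(* Averaging over the translates [p + h], [h < W], changes the sum only by boundary terms. *)
Lemma ksum_window_bound (y : list nat -> R) (B c : R) (W lo k n : nat) :
  0 <= B -> 0 <= c -> (1 <= W)%nat -> (forall p, Rabs (y p) <= B) ->
  (forall p, In p (ksubsets (S k) (seq 0 n)) -> spaced W lo p = true ->
     rsum (map (fun h => y (map (Nat.add h) p)) (seq 0 W)) <= c) ->
  INR W * ksum y (S k) (seq 0 n) <=
    INR (bin n (S k)) * c + INR W * B * (2 * INR W + INR (k * W + lo)) * INR (bin n k).
Proof.
  intros HB Hc HW Hy Hgood.
  assert (H1 : INR W * ksum y (S k) (seq 0 n) <=
    rsum (map (fun h => ksum y (S k) (seq h n)) (seq 0 W)) + INR W * (INR W * (2 * INR (bin n k) * B))).
  { assert (Hc' : forall r, INR W * r = rsum (map (fun _ => r) (seq 0 W)))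
      by (intros r; now rewrite rsum_const, length_seq).
    rewrite (Hc' (ksum y (S k) (seq 0 n))), (Hc' (INR W * (2 * INR (bin n k) * B))), <- rsum_plus.
    apply rsum_le. intros h Hh. apply in_seq in Hh.
    pose proof (ksum_shift y B k h n Hy) as H.
    pose proof (Rle_abs (- (ksum y (S k) (seq h n) - ksum y (S k) (seq 0 n)))) as H'.
    rewrite Rabs_Ropp in H'.
    assert (INR h * (2 * INR (bin n k) * B) <= INR W * (2 * INR (bin n k) * B)).
    { apply Rmult_le_compat_r; [|apply le_INR; lia].
      pose proof (pos_INR (bin n k)). nra. }
    lra. }
  assert (H2 : rsum (map (fun h => ksum y (S k) (seq h n)) (seq 0 W)) <=
     ksum (fun p => c + INR W * B * gap W lo p) (S k) (seq 0 n)).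
  { rewrite (map_ext _ _ (fun h => eq_sym (ksum_translate y h (S k) n))).
    unfold ksum. rewrite rsum_exchange. apply rsum_le. intros p Hp.
    unfold gap. destruct (spaced W lo p) eqn:Hsp.
    - specialize (Hgood p Hp Hsp). lra.
    - apply Rle_trans with (rsum (map (fun _ => B) (seq 0 W))).
      + apply rsum_le. intros h _. pose proof (Rle_abs (y (map (Nat.add h) p))).
        specialize (Hy (map (Nat.add h) p)). lra.
      + rewrite rsum_const, length_seq. lra. }
  assert (H3 : ksum (fun p => c + INR W * B * gap W lo p) (S k) (seq 0 n) =
    INR (bin n (S k)) * c + INR W * B * ksum (gap W lo) (S k) (seq 0 n)).
  { unfold ksum. rewrite rsum_plus, rsum_scal, rsum_const, length_ksubsets, length_seq. reflexivity. }
  pose proof (ksum_gap W lo k 0 n HW) as H4. rewrite Nat.sub_0_r in H4.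
  assert (HWB : 0 <= INR W * B) by (apply Rmult_le_pos; [apply pos_INR|assumption]).
  pose proof (Rmult_le_compat_l _ _ _ HWB H4). nra.
Qed.

Lemma rsum_few_large (y : nat -> R) (B th : R) (l : list nat) :
  0 <= th -> (forall h, y h <= B) ->
  rsum (map y l) <= INR (length (filter (fun h => if Rle_lt_dec th (y h) then true else false) l)) * B
     + INR (length l) * th.
Proof.
  intros Hth HB. induction l as [|h l IH]; [unfold rsum; simpl; lra|].
  change (rsum (map y (h :: l))) with (y h + rsum (map y l)).
  simpl length. simpl filter. destruct (Rle_lt_dec th (y h)) as [H|H]; simpl length;
    rewrite ?S_INR; specialize (HB h); lra.
Qed.

(** * Plegma families as interleaved lists *)

Lemma nth_map_lt (g : nat -> nat) p i : (i < length p)%nat -> nth i (map g p) 0%nat = g (nth i p 0%nat).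
Proof.
  intros H. rewrite (nth_indep _ 0%nat (g 0%nat)) by (now rewrite length_map). apply map_nth.
Qed.

Definition pick (m k j : nat) (u : list nat) : list nat :=
  map (fun i => nth (i * m + j) u 0%nat) (seq 0 k).

Definition interleave (m k : nat) (s : nat -> list nat) : list nat :=
  map (fun p => nth (p / m) (s (p mod m)) 0%nat) (seq 0 (m * k)).

Lemma length_pick m k j u : length (pick m k j u) = k.
Proof. unfold pick. now rewrite length_map, length_seq. Qed.

Lemma nth_pick m k j u i : (i < k)%nat -> nth i (pick m k j u) 0%nat = nth (i * m + j) u 0%nat.
Proof.
  intros H. unfold pick. rewrite nth_map_lt by (now rewrite length_seq).
  now rewrite seq_nth by assumption.
Qed.

Lemma length_interleave m k s : length (interleave m k s) = (m * k)%nat.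
Proof. unfold interleave. now rewrite length_map, length_seq. Qed.

Lemma nth_interleave m k s i j : (i < k)%nat -> (j < m)%nat ->
  nth (i * m + j) (interleave m k s) 0%nat = nth i (s j) 0%nat.
Proof.
  intros Hi Hj. unfold interleave. assert (H : (i * m + j < m * k)%nat) by nia.
  rewrite nth_map_lt by (now rewrite length_seq).
  rewrite seq_nth by assumption. simpl.
  replace ((i * m + j) / m)%nat with i; [replace ((i * m + j) mod m)%nat with j; [reflexivity|]|].
  - rewrite Nat.add_comm, Nat.Div0.mod_add, Nat.mod_small; lia.
  - rewrite Nat.add_comm, Nat.div_add, Nat.div_small; lia.
Qed.

Lemma pick_interleave m k s j : (j < m)%nat -> length (s j) = k ->
  pick m k j (interleave m k s) = s j.
Proof.
  intros Hj Hl. apply (nth_ext _ _ 0%nat 0%nat); rewrite length_pick; [easy|].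
  intros i Hi. now rewrite nth_pick, nth_interleave.
Qed.

(** Within a block of m positions the list increases by the row condition; the passage from one
    block to the next, at j = m - 1, is the last condition of a plegma family. *)
Lemma interleave_plegma M k m s : plegma M k m s -> ksubset_of M (m * k) (interleave m k s).
Proof.
  intros (Hs & Hrow & Hcol). split; [apply length_interleave|]. split.
  - intros p. rewrite length_interleave. intros Hp.
    assert (Hm : (0 < m)%nat) by nia.
    pose proof (Nat.div_mod p m ltac:(lia)) as Hdm.
    pose proof (Nat.mod_upper_bound p m ltac:(lia)) as Hr.
    set (i := (p / m)%nat) in *. set (j := (p mod m)%nat) in *.
    replace p with (i * m + j)%nat by lia.
    assert (Hi : (i < k)%nat) by nia.
    rewrite nth_interleave by assumption.
    destruct (Nat.eq_dec (S j) m) as [Hj|Hj].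
    + assert (HSi : (S i < k)%nat) by nia.
      replace (S (i * m + j)) with (S i * m + 0)%nat by nia.
      rewrite nth_interleave by assumption.
      replace j with (pred m) by lia. now apply Hcol.
    + replace (S (i * m + j)) with (i * m + S j)%nat by lia.
      rewrite nth_interleave by lia. apply Hrow; lia.
  - intros p Hp. assert (Hm : (0 < m)%nat) by nia.
    pose proof (Nat.div_mod p m ltac:(lia)) as Hdm.
    pose proof (Nat.mod_upper_bound p m ltac:(lia)) as Hr.
    set (i := (p / m)%nat) in *. set (j := (p mod m)%nat) in *.
    replace p with (i * m + j)%nat by lia.
    assert (Hi : (i < k)%nat) by nia.
    rewrite nth_interleave by assumption. now apply (Hs j Hr).
Qed.

Lemma infinite_enum_lt M i j : infinite_enum M -> (i < j)%nat -> (M i < M j)%nat.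
Proof.
  intros HM Hij. induction Hij as [|j Hij IH]; [apply HM|].
  apply Nat.lt_trans with (1 := IH), HM.
Qed.

Lemma infinite_enum_le M i j : infinite_enum M -> (i <= j)%nat -> (M i <= M j)%nat.
Proof.
  intros HM Hij. destruct (Nat.eq_dec i j) as [->|]; [lia|].
  apply Nat.lt_le_incl, infinite_enum_lt; [assumption|lia].
Qed.

Lemma sub_enum_ge L M i : infinite_enum L -> infinite_enum M -> sub_enum L M -> (M i <= L i)%nat.
Proof.
  intros HL HM Hs. assert (H : forall i, exists j, L i = M j /\ (i <= j)%nat).
  { clear i. induction i as [|i (j & Hj & Hij)].
    - destruct (Hs 0%nat) as [j Hj]. exists j. split; [assumption|lia].
    - destruct (Hs (S i)) as [j' Hj']. exists j'. split; [assumption|].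
      apply Nat.le_succ_l, Nat.le_lt_trans with (1 := Hij).
      apply Nat.nle_gt. intros H. apply (infinite_enum_le M) in H; [|assumption].
      specialize (HL i). lia. }
  destruct (H i) as (j & -> & Hij). now apply infinite_enum_le.
Qed.

Lemma spaced_nth W lo p : spaced W lo p = true ->
  (forall i, (S i < length p)%nat -> (nth i p 0 + W <= nth (S i) p 0)%nat) /\
  ((0 < length p)%nat -> (lo <= nth 0 p 0)%nat).
Proof.
  revert lo. induction p as [|a p IH]; intros lo; simpl; [split; intros; lia|].
  rewrite Bool.andb_true_iff, Nat.leb_le. intros [Hlo Hp].
  destruct (IH _ Hp) as [H1 H2]. split; [|auto].
  intros [|i] Hi; [apply H2; lia|]. apply H1. lia.
Qed.

(** The set [p] consists of positions in L, so that translation makes sense for an arbitrary L. The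
    last plegma condition holds because h + p(i) < p(i) + W <= p(i + 1). *)
Lemma translates_plegma (L M : nat -> nat) (W lo k m : nat) (p hs : list nat) :
  (1 <= W)%nat -> infinite_enum L -> sub_enum L M -> length p = k -> spaced W lo p = true ->
  (m <= length hs)%nat -> (forall h, In h hs -> (h < W)%nat) ->
  (forall i j, (i < j)%nat -> (j < length hs)%nat -> (nth i hs 0 < nth j hs 0)%nat) ->
  plegma M k m (fun j => map L (map (Nat.add (nth j hs 0%nat)) p)).
Proof.
  intros HW HL HLM Hp Hsp Hm HhW Hinc. destruct (spaced_nth _ _ _ Hsp) as [Hgap _].
  assert (Hnth : forall i h, (i < k)%nat -> nth i (map L (map (Nat.add h) p)) 0%nat = L (h + nth i p 0)%nat).
  { intros i h Hi. rewrite nth_map_lt, nth_map_lt; rewrite ?length_map; lia. }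
  repeat split.
  - now rewrite !length_map.
  - intros i. rewrite !length_map, Hp. intros Hi. rewrite !Hnth by lia.
    apply infinite_enum_lt; [assumption|]. specialize (Hgap i). lia.
  - intros i Hi. rewrite Hnth by assumption. apply HLM.
  - intros i j Hi Hj. rewrite !Hnth by assumption. apply infinite_enum_lt; [assumption|].
    specialize (Hinc j (S j)). lia.
  - intros i Hi Hm0. rewrite !Hnth by lia. apply infinite_enum_lt; [assumption|].
    specialize (Hgap i). specialize (HhW (nth (pred m) hs 0%nat) ltac:(apply nth_In; lia)).
    lia.
Qed.

Lemma filter_seq_increasing (f : nat -> bool) (a n : nat) :
  forall i j, (i < j)%nat -> (j < length (filter f (seq a n)))%nat ->
  (nth i (filter f (seq a n)) 0 < nth j (filter f (seq a n)) 0)%nat.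
Proof.
  revert a. induction n as [|n IH]; intros a i j Hij Hj; simpl in *; [lia|].
  destruct (f a); [|now apply IH].
  destruct j as [|j]; [lia|]. simpl in Hj. destruct i as [|i].
  - simpl. assert (H : In (nth j (filter f (seq (S a) n)) 0%nat) (filter f (seq (S a) n)))
      by (apply nth_In; lia).
    apply filter_In in H. destruct H as [H _]. apply in_seq in H. lia.
  - simpl. apply IH; lia.
Qed.

Lemma ksubsets_length k l p : In p (ksubsets k l) -> length p = k.
Proof.
  revert k p. induction l as [|h t IH]; intros [|k] p; simpl; try (intros [<-|[]]; reflexivity); [easy|].
  rewrite in_app_iff, in_map_iff. intros [(q & <- & Hq)|H]; [|now apply IH].
  simpl. f_equal. now apply IH.
Qed.

(** * Finite sums and norms of linear combinations *)

Fixpoint csum (a : nat -> R) (m : nat) : R :=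
  match m with O => 0 | S m' => csum a m' + a m' end.

Lemma csum_ext a b m : (forall j, (j < m)%nat -> a j = b j) -> csum a m = csum b m.
Proof. induction m as [|m IH]; simpl; intros H; [reflexivity|]. rewrite IH, H; auto. Qed.

Lemma csum_le a b m : (forall j, (j < m)%nat -> a j <= b j) -> csum a m <= csum b m.
Proof. induction m as [|m IH]; simpl; intros H; [lra|]. apply Rplus_le_compat; auto. Qed.

Lemma csum_plus a b m : csum (fun j => a j + b j) m = csum a m + csum b m.
Proof. induction m as [|m IH]; simpl; [ring|]. rewrite IH. ring. Qed.

Lemma csum_scal c a m : csum (fun j => c * a j) m = c * csum a m.
Proof. induction m as [|m IH]; simpl; [ring|]. rewrite IH. ring. Qed.

Lemma csum_nonneg a m : (forall j, (j < m)%nat -> 0 <= a j) -> 0 <= csum a m.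
Proof. induction m as [|m IH]; simpl; intros H; [lra|]. apply Rplus_le_le_0_compat; auto. Qed.

Lemma csum_abs_fold a m :
  fold_right Rplus 0 (map (fun j => Rabs (a j)) (seq 0 m)) = csum (fun j => Rabs (a j)) m.
Proof.
  induction m as [|m IH]; [reflexivity|].
  rewrite seq_S, map_app. change (fold_right Rplus 0) with rsum.
  rewrite rsum_app. unfold rsum at 1. rewrite IH. simpl. unfold rsum. simpl. ring.
Qed.

Lemma snorm_lincomb_le (E : Seminormed) a (v : nat -> E) B m :
  (forall j, (j < m)%nat -> snorm E (v j) <= B) ->
  snorm E (lincomb a v m) <= B * csum (fun j => Rabs (a j)) m.
Proof.
  induction m as [|m IH]; simpl; intros H; [rewrite snorm_zero; lra|].
  apply Rle_trans with (1 := snorm_triangle E _ _). rewrite snorm_homog.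
  specialize (IH (fun j Hj => H j (Nat.lt_lt_succ_r _ _ Hj))).
  pose proof (Rmult_le_compat_l _ _ _ (Rabs_pos (a m)) (H m (Nat.lt_succ_diag_r m))). lra.
Qed.

Lemma linear_lincomb (V : VecSpace) (f : V -> R) :
  (forall x y, f (x ⊕ y) = f x + f y) -> (forall a x, f (a ⊙ x) = a * f x) ->
  forall a v m, f (lincomb a v m) = csum (fun j => a j * f (v j)) m.
Proof.
  intros Ha Hs a v m. induction m as [|m IH]; simpl; [now apply linear_zero|].
  now rewrite Ha, Hs, IH.
Qed.

Lemma lincomb_const (V : VecSpace) (a : nat -> R) (w : V) m :
  lincomb a (fun _ => w) m = csum a m ⊙ w.
Proof.
  induction m as [|m IH]; simpl; [now rewrite vscal_zero|].
  now rewrite IH, vscal_distr_r.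
Qed.

(** * Iterated weak limits of a [k]-sequence *)

(* The number of positions [p < n] with [p = j] modulo [m]. *)
Definition cnt (m j n : nat) : nat := (n / m + if Nat.ltb j (n mod m) then 1 else 0)%nat.

Lemma cnt_0 m j : cnt m j 0 = 0%nat.
Proof. unfold cnt. rewrite Nat.Div0.div_0_l, Nat.Div0.mod_0_l. reflexivity. Qed.

Lemma cnt_decomp m j q r : (r < m)%nat ->
  cnt m j (q * m + r) = (q + if Nat.ltb j r then 1 else 0)%nat.
Proof.
  intros Hr. unfold cnt.
  replace ((q * m + r) / m)%nat with q by (rewrite Nat.add_comm, Nat.div_add, Nat.div_small; lia).
  replace ((q * m + r) mod m)%nat with r by (rewrite Nat.add_comm, Nat.Div0.mod_add, Nat.mod_small; lia).
  reflexivity.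
Qed.

Lemma cnt_full m j k : (0 < m)%nat -> cnt m j (m * k) = k.
Proof.
  intros Hm. replace (m * k)%nat with (k * m + 0)%nat by lia. rewrite cnt_decomp by assumption.
  simpl. lia.
Qed.

Lemma cnt_S m j n : (j < m)%nat ->
  cnt m j (S n) = (cnt m j n + if Nat.eqb (n mod m) j then 1 else 0)%nat /\
  (forall i, (i < cnt m j n)%nat -> (i * m + j < n)%nat) /\
  ((n mod m)%nat = j -> (cnt m j n * m + j)%nat = n).
Proof.
  intros Hj. pose proof (Nat.div_mod n m ltac:(lia)) as Hdm.
  pose proof (Nat.mod_upper_bound n m ltac:(lia)) as Hr.
  set (q := (n / m)%nat) in *. set (r := (n mod m)%nat) in *.
  replace n with (q * m + r)%nat by lia.
  rewrite (cnt_decomp m j q r) by assumption. repeat split.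
  - destruct (Nat.eq_dec (S r) m) as [Hm|Hm].
    + replace (S (q * m + r)) with (S q * m + 0)%nat by nia.
      rewrite cnt_decomp by lia.
      destruct (Nat.ltb_spec j r), (Nat.ltb_spec j 0), (Nat.eqb_spec r j); lia.
    + replace (S (q * m + r)) with (q * m + S r)%nat by lia.
      rewrite cnt_decomp by lia.
      destruct (Nat.ltb_spec j r), (Nat.ltb_spec j (S r)), (Nat.eqb_spec r j); lia.
  - intros i Hi. destruct (Nat.ltb_spec j r); nia.
  - intros ->. rewrite Nat.ltb_irrefl. lia.
Qed.

Definition part (m j : nat) (t : list nat) : list nat := pick m (cnt m j (length t)) j t.

Lemma part_snoc m j t n : (j < m)%nat ->
  part m j (t ++ [n]) = part m j t ++ (if Nat.eqb (length t mod m) j then [n] else []).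
Proof.
  intros Hj. destruct (cnt_S m j (length t) Hj) as (H1 & H2 & H3).
  unfold part. rewrite length_app. simpl length. rewrite Nat.add_1_r, H1.
  assert (Hold : pick m (cnt m j (length t)) j (t ++ [n]) = pick m (cnt m j (length t)) j t).
  { unfold pick. apply map_ext_in. intros i Hi. apply in_seq in Hi.
    apply app_nth1. apply H2. lia. }
  destruct (Nat.eqb_spec (length t mod m) j) as [He|He].
  - rewrite Nat.add_1_r. unfold pick at 1. rewrite seq_S, map_app. fold (pick m (cnt m j (length t)) j (t ++ [n])).
    rewrite Hold. f_equal. simpl. rewrite (H3 He), app_nth2, Nat.sub_diag by lia. reflexivity.
  - now rewrite Nat.add_0_r, app_nil_r.
Qed.

Section IteratedLimits.
Variable X : Banach.
Variable U : (nat -> Prop) -> Prop.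
Hypothesis HU : free_ultrafilter U.
Variable K : X -> Prop.
Hypothesis HK : weakly_compact X K.
Variable B : R.
Hypothesis HB : forall z, K z -> snorm X z <= B.
Variable x : list nat -> X.
Hypothesis Hx : forall s, K (x s).
Variable k : nat.

Definition wlim (y : nat -> X) : X :=
  epsilon (inhabits (vzero X)) (fun w => K w /\ weak_ucv X U y w).

Lemma wlim_spec y : (forall n, K (y n)) -> K (wlim y) /\ weak_ucv X U y (wlim y).
Proof.
  intros Hy. apply (epsilon_spec (inhabits (vzero X)) (fun w => K w /\ weak_ucv X U y w)).
  now apply (weak_ulimit_exists X U HU K).
Qed.

(** Here [d] counts the entries still to come. With none known, [hat k []] is the point x0 of the
    overview. *)
Fixpoint hat (d : nat) (t : list nat) : X :=
  match d with
  | O => x t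
  | S d' => wlim (fun n => hat d' (t ++ [n]))
  end.

Lemma hat_in d t : K (hat d t).
Proof.
  revert t. induction d as [|d IH]; intros t; simpl; [apply Hx|]. now apply wlim_spec.
Qed.

Lemma hat_ucv d t : weak_ucv X U (fun n => hat d (t ++ [n])) (hat (S d) t).
Proof. simpl. apply wlim_spec. intros n. apply hat_in. Qed.

(* The list [t] is a prefix of an interleaved family of [m] sets; the part of the [j]-th set
   that is already known is completed by iterated weak limits. *)
Definition phat (m j : nat) (t : list nat) : X := hat (k - cnt m j (length t)) (part m j t).

Lemma phat_nil m j : phat m j [] = hat k [].
Proof. unfold phat, part. simpl. rewrite cnt_0, Nat.sub_0_r. reflexivity. Qed.

Lemma phat_full m j u : (0 < m)%nat -> length u = (m * k)%nat -> phat m j u = x (pick m k j u).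
Proof.
  intros Hm Hu. unfold phat, part. rewrite Hu, cnt_full, Nat.sub_diag by assumption. reflexivity.
Qed.

Lemma phat_snoc_other m j t n : (j < m)%nat -> (length t mod m)%nat <> j ->
  phat m j (t ++ [n]) = phat m j t.
Proof.
  intros Hj Hne. unfold phat. rewrite part_snoc by assumption.
  rewrite length_app. simpl length. rewrite Nat.add_1_r.
  rewrite (proj1 (cnt_S m j (length t) Hj)).
  destruct (Nat.eqb_spec (length t mod m) j); [easy|].
  now rewrite Nat.add_0_r, app_nil_r.
Qed.

(** The next entry goes to the set numbered [length t mod m]. For this set the claim is the defining
    limit of [hat]; the other sets do not move. *)
Lemma phat_ucv m j t : (j < m)%nat -> (length t < m * k)%nat ->
  weak_ucv X U (fun n => phat m j (t ++ [n])) (phat m j t).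
Proof.
  intros Hj Ht. destruct (Nat.eq_dec (length t mod m) j) as [He|He].
  - destruct (cnt_S m j (length t) Hj) as (H1 & H2 & H3). specialize (H3 He).
    assert (Hc : (cnt m j (length t) < k)%nat) by nia.
    pose proof (hat_ucv (k - S (cnt m j (length t))) (part m j t)) as H.
    replace (S (k - S (cnt m j (length t)))) with (k - cnt m j (length t))%nat in H by lia.
    intros f Hf. apply (ucv_ext U HU (fun n => f (hat (k - S (cnt m j (length t))) (part m j t ++ [n])))).
    + apply (uf_all U HU). intros n. f_equal. unfold phat. rewrite part_snoc by assumption.
      rewrite length_app. simpl length. rewrite Nat.add_1_r, H1.
      destruct (Nat.eqb_spec (length t mod m) j); [|easy]. now rewrite Nat.add_1_r.
    + apply (H f Hf).
  - intros f Hf. apply (ucv_ext U HU (fun n => f (phat m j t))); [|now apply ucv_const].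
    apply (uf_all U HU). intros n. now rewrite phat_snoc_other.
Qed.

Section Replace.
Variables (m : nat) (a : nat -> R) (J : nat -> bool).

Definition on_J (j : nat) : R := if J j then a j else 0.
Definition off_J (j : nat) : R := if J j then 0 else a j.

Definition sum_J (u : list nat) : X := lincomb on_J (fun j => x (pick m k j u)) m.

Definition shifted_norm (w : X) (u : list nat) : R := snorm X (sum_J u ⊕ w).

Lemma sum_J_bound u : snorm X (sum_J u) <= B * csum (fun j => Rabs (on_J j)) m.
Proof. apply snorm_lincomb_le. intros j _. apply HB, Hx. Qed.

Lemma shifted_norm_bound w u : Rabs (shifted_norm w u) <= B * csum (fun j => Rabs (on_J j)) m + snorm X w.
Proof.
  unfold shifted_norm. rewrite Rabs_pos_eq by apply snorm_nonneg.
  pose proof (snorm_triangle X (sum_J u) w). pose proof (sum_J_bound u). lra.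
Qed.

(* One step of the iterated limit moves one new entry. If it belongs to a set in [J] the
   vector off [J] does not change; otherwise the limit over the remaining entries is a convex
   Lipschitz function of that vector, hence weakly lower semicontinuous. *)
Lemma iter_ucv_shifted_replace d t L L' : (length t + d = m * k)%nat ->
  iter_ucv U d (fun u => shifted_norm (lincomb off_J (fun j => x (pick m k j u)) m) u) t L ->
  iter_ucv U d (shifted_norm (lincomb off_J (fun j => phat m j t) m)) t L' ->
  L' <= L.
Proof.
  destruct (Nat.eq_dec m 0) as [Hm0|Hm0].
  { intros _ H H'. apply (iter_ucv_le U HU d _ _ t _ _ H' H). apply (iter_uf_all U HU). intros u _.
    rewrite Hm0. simpl. lra. }
  set (A := fun u => shifted_norm (lincomb off_J (fun j => x (pick m k j u)) m) u).
  set (C := B * csum (fun j => Rabs (on_J j)) m).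
  set (C' := B * csum (fun j => Rabs (off_J j)) m).
  assert (HA : forall u, Rabs (A u) <= C + C').
  { intros u. unfold A. apply Rle_trans with (1 := shifted_norm_bound _ u).
    apply Rplus_le_compat_l. apply snorm_lincomb_le. intros j _. apply HB, Hx. }
  revert t L L'. induction d as [|d IH]; intros t L L' Ht HL HL'.
  - apply (iter_ucv_le U HU 0 _ _ t _ _ HL' HL). simpl. right. unfold A. f_equal.
    apply lincomb_ext; [reflexivity|]. intros j Hj. apply phat_full; lia.
  - destruct (choice _ (fun n => iter_ucv_exists U HU d A _ (t ++ [n]) HA)) as [Ln HLn].
    pose proof (iter_ucv_step U HU d A t L Ln HL HLn) as HLL.
    (* The entry 0 is a placeholder for the new one. [psi] is used only when the set receiving that
       entry is outside J, and then the value is irrelevant. *)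
    destruct (choice _ (fun w => iter_ucv_exists U HU d (shifted_norm w) _ (t ++ [0%nat]) (shifted_norm_bound w))) as [psi Hpsi].
    set (w := lincomb off_J (fun j => phat m j t) m) in *.
    set (wn := fun n => lincomb off_J (fun j => phat m j (t ++ [n])) m).
    destruct (J (length t mod m)) eqn:HJ.
    + assert (Hw : forall n, wn n = w).
      { intros n. unfold wn, w.
        assert (H : forall m', (m' <= m)%nat ->
          lincomb off_J (fun j => phat m j (t ++ [n])) m' = lincomb off_J (fun j => phat m j t) m').
        { induction m' as [|m' IHm]; intros Hm'; simpl; [reflexivity|]. rewrite IHm by lia. f_equal.
          destruct (Nat.eq_dec (length t mod m) m') as [He|He].
          - unfold off_J. rewrite <- He, HJ. now rewrite !vscal_zero.
          - rewrite phat_snoc_other; [reflexivity|lia|assumption]. }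
        now apply H. }
      destruct (choice _ (fun n => iter_ucv_exists U HU d (shifted_norm w) _ (t ++ [n]) (shifted_norm_bound w))) as [Nn HNn].
      pose proof (iter_ucv_step U HU d _ t L' Nn HL' HNn) as HNL.
      apply (ucv_le U HU Nn Ln); [assumption|assumption|].
      apply (uf_all U HU). intros n. apply (IH (t ++ [n])).
      * rewrite length_app. simpl. lia.
      * apply HLn.
      * fold (wn n). rewrite Hw. apply HNn.
    (* The new entry is read only by a set whose coefficient in [sum_J] is zero, so the limit over
       the remaining entries does not depend on it. *)
    + assert (Hind : forall v n, iter_ucv U d (shifted_norm v) (t ++ [n]) (psi v)).
      { intros v n eps He. apply (iter_uf_transport U HU d (fun u => Rabs (shifted_norm v u - psi v) < eps) _ (t ++ [0%nat])).
        - now rewrite !length_app.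
        - intros u _. replace (shifted_norm v ((t ++ [n]) ++ u)) with (shifted_norm v ((t ++ [0%nat]) ++ u)); [auto|].
          unfold shifted_norm. f_equal. f_equal. unfold sum_J.
          assert (H : forall m', (m' <= m)%nat ->
             lincomb on_J (fun j => x (pick m k j ((t ++ [0%nat]) ++ u))) m' =
             lincomb on_J (fun j => x (pick m k j ((t ++ [n]) ++ u))) m').
          { induction m' as [|m' IHm]; intros Hm'; simpl; [reflexivity|]. rewrite IHm by lia. f_equal.
            destruct (Nat.eq_dec (length t mod m) m') as [He'|He'].
            - unfold on_J. rewrite <- He', HJ. now rewrite !vscal_zero.
            - f_equal. f_equal. unfold pick. apply map_ext. intros i.
              rewrite <- !app_assoc. simpl.
              assert (Hne : (i * m + m')%nat <> length t).
              { intros Heq. apply He'. rewrite <- Heq, Nat.add_comm, Nat.Div0.mod_add, Nat.mod_small; lia. }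
              destruct (Nat.lt_ge_cases (i * m + m') (length t)) as [Hlt|Hge].
              + now rewrite !app_nth1 by assumption.
              + rewrite !app_nth2 by assumption.
                destruct (i * m + m' - length t)%nat eqn:Hd; [lia|reflexivity]. }
          now apply H.
        - now apply Hpsi. }
      assert (Hlip : forall v b, psi (v ⊕ b) <= psi v + snorm X b).
      { intros v b.
        replace (psi v + snorm X b) with (1 * psi v + 1 * snorm X b) by ring.
        apply (iter_ucv_le U HU d (shifted_norm (v ⊕ b))
          (fun u => 1 * shifted_norm v u + 1 * snorm X b) (t ++ [0%nat])).
        - apply Hpsi.
        - apply (iter_ucv_lin U HU d 1 1 (shifted_norm v) (fun _ => snorm X b)); [apply Hpsi|now apply iter_ucv_const].
        - apply (iter_uf_all U HU). intros u _. unfold shifted_norm.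
          replace (sum_J u ⊕ (v ⊕ b)) with ((sum_J u ⊕ v) ⊕ b) by vring.
          pose proof (snorm_triangle X (sum_J u ⊕ v) b). lra. }
      assert (Hconv : forall v b s, 0 <= s <= 1 ->
         psi (s ⊙ v ⊕ (1 - s) ⊙ b) <= s * psi v + (1 - s) * psi b).
      { intros v b s Hs.
        apply (iter_ucv_le U HU d (shifted_norm (s ⊙ v ⊕ (1 - s) ⊙ b))
          (fun u => s * shifted_norm v u + (1 - s) * shifted_norm b u) (t ++ [0%nat])).
        - apply Hpsi.
        - apply (iter_ucv_lin U HU d); apply Hpsi.
        - apply (iter_uf_all U HU). intros u _. unfold shifted_norm.
          replace (sum_J u ⊕ (s ⊙ v ⊕ (1 - s) ⊙ b)) with
            (s ⊙ (sum_J u ⊕ v) ⊕ (1 - s) ⊙ (sum_J u ⊕ b)) by vring.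
          apply Rle_trans with (1 := snorm_triangle X _ _).
          rewrite !snorm_homog, !Rabs_pos_eq by lra. lra. }
      assert (Hwn : weak_ucv X U wn w).
      { apply (weak_ucv_lincomb X U HU). intros j Hj. apply phat_ucv; lia. }
      destruct (ucv_exists U HU (fun n => psi (wn n)) (C + C')) as [r Hr].
      { intros n. apply Rabs_le. split.
        - apply (iter_ucv_le U HU d (fun _ => - (C + C')) (shifted_norm (wn n)) (t ++ [0%nat]));
            [now apply iter_ucv_const|apply Hpsi|].
          apply (iter_uf_all U HU). intros u _. pose proof (HA u) as H. pose proof (Rabs_pos (A u)).
          unfold shifted_norm. pose proof (snorm_nonneg X (sum_J u ⊕ wn n)). lra.
        - apply (iter_ucv_le U HU d (shifted_norm (wn n)) (fun _ => C + C') (t ++ [0%nat]));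
            [apply Hpsi|now apply iter_ucv_const|].
          apply (iter_uf_all U HU). intros u _. pose proof (shifted_norm_bound (wn n) u) as H.
          pose proof (Rle_abs (shifted_norm (wn n) u)).
          assert (snorm X (wn n) <= C').
          { apply snorm_lincomb_le. intros j _. apply HB, hat_in. }
          unfold C. lra. }
      (* The chain is L' = psi w <= lim psi (wn n) <= lim Ln n = L: semicontinuity first, then the
         induction hypothesis for each n. *)
      pose proof (weak_lower_semicontinuous X U HU psi wn w r Hlip Hconv Hwn Hr) as Hlsc.
      pose proof (iter_ucv_step U HU d _ t L' (fun _ => psi w) HL' (Hind w)) as HL'c.
      rewrite (ucv_unique U HU _ _ _ HL'c (ucv_const U HU (psi w))).
      apply Rle_trans with (1 := Hlsc).
      apply (ucv_le U HU (fun n => psi (wn n)) Ln); [assumption|assumption|].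
      apply (uf_all U HU). intros n. apply (IH (t ++ [n])).
      * rewrite length_app. simpl. lia.
      * apply HLn.
      * apply Hind.
Qed.

End Replace.

Definition plegma_norm (m : nat) (a : nat -> R) (u : list nat) : R :=
  snorm X (lincomb a (fun j => x (pick m k j u)) m).

Definition separated (th : R) (m : nat) (u : list nat) : Prop :=
  exists f, dual_ball X f /\ forall j, (j < m)%nat -> th <= f (x (pick m k j u)) - f (hat k []).

Lemma iter_ucv_plegma_norm_replace m a J N : iter_ucv U (m * k) (plegma_norm m a) [] N ->
  exists L', iter_ucv U (m * k) (shifted_norm m a J (csum (off_J a J) m ⊙ hat k [])) [] L' /\ L' <= N.
Proof.
  intros HN.
  destruct (iter_ucv_exists U HU (m * k) (shifted_norm m a J (csum (off_J a J) m ⊙ hat k [])) _ []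
     (shifted_norm_bound m a J _)) as [L' HL'].
  exists L'. split; [assumption|].
  apply (iter_ucv_shifted_replace m a J (m * k) [] N L'); [reflexivity| |].
  - intros eps He. apply (iter_uf_mono U HU (m * k) (fun u => Rabs (plegma_norm m a u - N) < eps)); [|now apply HN].
    intros u _. unfold plegma_norm, shifted_norm, sum_J.
    assert (H : forall v : nat -> X, lincomb a v m = lincomb (on_J a J) v m ⊕ lincomb (off_J a J) v m).
    { intros v. rewrite <- lincomb_plus. apply lincomb_ext; [|reflexivity]. intros j _.
      unfold on_J, off_J. destruct (J j); ring. }
    now rewrite H.
  - rewrite (lincomb_ext X _ (off_J a J) _ (fun _ => hat k [])); [|reflexivity|intros; apply phat_nil].
    now rewrite lincomb_const.
Qed.

(* Keep only the sets with nonnegative coefficients, replacing the others by the weak limit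
   [x0]; the error term [|sum a| |x0|] is itself at most [N], by replacing all sets. *)
Lemma plegma_norm_lower_pos th m a N : 0 < th -> iter_uf U (m * k) (separated th m) [] ->
  iter_ucv U (m * k) (plegma_norm m a) [] N -> th * csum (fun j => Rmax (a j) 0) m <= 2 * N.
Proof.
  intros Hth Hsep HN. set (x0 := hat k []).
  assert (H0 : Rabs (csum a m) * snorm X x0 <= N).
  { destruct (iter_ucv_plegma_norm_replace m a (fun _ => false) N HN) as (L' & HL' & Hle).
    apply Rle_trans with (2 := Hle).
    apply (iter_ucv_le U HU (m * k) (fun _ => Rabs (csum a m) * snorm X x0) _ [] _ _ (iter_ucv_const U HU _ _ _) HL').
    apply (iter_uf_all U HU). intros u _. right. unfold shifted_norm, sum_J.
    rewrite lincomb_zero by reflexivity. rewrite vadd_zero, snorm_homog. reflexivity. }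
  set (J := fun j => if Rle_lt_dec 0 (a j) then true else false).
  destruct (iter_ucv_plegma_norm_replace m a J N HN) as (L' & HL' & Hle).
  assert (HJ : csum (on_J a J) m = csum (fun j => Rmax (a j) 0) m).
  { apply csum_ext. intros j _. unfold on_J, J. destruct (Rle_lt_dec 0 (a j)).
    - now rewrite Rmax_left.
    - rewrite Rmax_right; lra. }
  assert (Hsum : csum a m = csum (on_J a J) m + csum (off_J a J) m).
  { rewrite <- csum_plus. apply csum_ext. intros j _. unfold on_J, off_J. destruct (J j); ring. }
  rewrite <- HJ.
  assert (H1 : th * csum (on_J a J) m - Rabs (csum a m) * snorm X x0 <= L'); [|lra].
  apply (iter_ucv_le U HU (m * k) (fun _ => th * csum (on_J a J) m - Rabs (csum a m) * snorm X x0)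
     _ [] _ _ (iter_ucv_const U HU _ _ _) HL').
  apply (iter_uf_mono U HU (m * k) (separated th m)); [|assumption].
  intros u _ (f & (Ha & Hs & Hb) & Hf). unfold shifted_norm.
  apply Rle_trans with (f (sum_J m a J u ⊕ csum (off_J a J) m ⊙ x0)).
  - rewrite Ha, Hs. unfold sum_J. rewrite (linear_lincomb _ f Ha Hs).
    (* The multiples of [f x0] from inside and outside J add up to [csum a m * f x0], which is what
       the error term absorbs. *)
    assert (H2 : (f x0 + th) * csum (on_J a J) m <= csum (fun j => on_J a J j * f (x (pick m k j u))) m).
    { rewrite <- csum_scal. apply csum_le. intros j Hj. rewrite Rmult_comm.
      apply Rmult_le_compat_l.
      - unfold on_J, J. destruct (Rle_lt_dec 0 (a j)); lra.
      - specialize (Hf j Hj). unfold x0. lra. }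
    assert (H3 : - (Rabs (csum a m) * snorm X x0) <= csum a m * f x0).
    { pose proof (Rle_abs (- (csum a m * f x0))) as H. rewrite Rabs_Ropp, Rabs_mult in H.
      pose proof (Rmult_le_compat_l _ _ _ (Rabs_pos (csum a m)) (Hb x0)). lra. }
    rewrite Hsum in H3. rewrite Hsum. lra.
  - pose proof (Rle_abs (f (sum_J m a J u ⊕ csum (off_J a J) m ⊙ x0))).
    specialize (Hb (sum_J m a J u ⊕ csum (off_J a J) m ⊙ x0)). unfold x0 in *. lra.
Qed.

(** The one-sided estimate is applied to a and to -a, which have the same limit norm, and |r| is the
    sum of the positive parts of r and -r. *)
Lemma plegma_norm_lower th m a N : 0 < th -> iter_uf U (m * k) (separated th m) [] ->
  iter_ucv U (m * k) (plegma_norm m a) [] N -> th / 4 * csum (fun j => Rabs (a j)) m <= N.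
Proof.
  intros Hth Hsep HN.
  pose proof (plegma_norm_lower_pos th m a N Hth Hsep HN) as H1.
  assert (HN' : iter_ucv U (m * k) (plegma_norm m (fun j => -1 * a j)) [] N).
  { intros eps He. apply (iter_uf_mono U HU (m * k) (fun u => Rabs (plegma_norm m a u - N) < eps)); [|now apply HN].
    intros u _. unfold plegma_norm. rewrite lincomb_scal, <- vopp_scal, snorm_opp. auto. }
  pose proof (plegma_norm_lower_pos th m _ N Hth Hsep HN') as H2.
  assert (H3 : csum (fun j => Rabs (a j)) m =
    csum (fun j => Rmax (a j) 0) m + csum (fun j => Rmax (-1 * a j) 0) m).
  { rewrite <- csum_plus. apply csum_ext. intros j _.
    destruct (Rle_lt_dec 0 (a j)).
    - rewrite Rabs_pos_eq, Rmax_left, Rmax_right; lra.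
    - rewrite Rabs_left, Rmax_right, Rmax_left; lra. }
  rewrite H3. lra.
Qed.

End IteratedLimits.

(** * Finitely supported sequences with a limit seminorm *)

(** The vectors [x s] may be linearly dependent, so the Hamel basis is realized on formal finite
    combinations. *)
Definition finsupp := {a : nat -> R | exists n, forall j, (n <= j)%nat -> a j = 0}.

Lemma finsupp_eq (a b : finsupp) : (forall j, proj1_sig a j = proj1_sig b j) -> a = b.
Proof.
  destruct a as [a Ha], b as [b Hb]. simpl. intros H.
  assert (a = b) by now apply functional_extensionality. subst b.
  f_equal. apply proof_irrelevance.
Qed.

Definition fs_zero : finsupp.
Proof. exists (fun _ => 0). now exists 0%nat. Defined.

Definition fs_add (a b : finsupp) : finsupp.
Proof.
  exists (fun j => proj1_sig a j + proj1_sig b j).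
  destruct a as [a [n Hn]], b as [b [m Hm]]. exists (max n m). intros j Hj. simpl.
  rewrite Hn, Hm by lia. ring.
Defined.

Definition fs_scal (c : R) (a : finsupp) : finsupp.
Proof.
  exists (fun j => c * proj1_sig a j).
  destruct a as [a [n Hn]]. exists n. intros j Hj. simpl. rewrite Hn by lia. ring.
Defined.

Definition fs_space : VecSpace.
Proof.
  refine (Build_VecSpace finsupp fs_zero fs_add (fs_scal (-1)) fs_scal _ _ _ _ _ _ _ _);
    intros; apply finsupp_eq; intros j; simpl; ring.
Defined.

Definition fs_unit (n : nat) : fs_space.
Proof.
  exists (fun j => if Nat.eqb j n then 1 else 0). exists (S n). intros j Hj.
  destruct (Nat.eqb_spec j n); [lia|reflexivity].
Defined.

Lemma lincomb_fs_unit a m j :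
  proj1_sig (lincomb a fs_unit m) j = if Nat.ltb j m then a j else 0.
Proof.
  induction m as [|m IH]; [reflexivity|]. simpl lincomb.
  change (proj1_sig (lincomb a fs_unit m) j + a m * (if Nat.eqb j m then 1 else 0) =
    if Nat.ltb j (S m) then a j else 0).
  rewrite IH. destruct (Nat.ltb_spec j m), (Nat.ltb_spec j (S m)), (Nat.eqb_spec j m);
    subst; try lia; ring.
Qed.

Lemma fs_unit_hamel : hamel_basis fs_unit.
Proof.
  split.
  - intros [a [n Hn]]. exists n, a. apply finsupp_eq. intros j. rewrite lincomb_fs_unit. simpl.
    destruct (Nat.ltb_spec j n); auto.
  - intros m a H j Hj. pose proof (lincomb_fs_unit a m j) as H1. rewrite H in H1. simpl in H1.
    destruct (Nat.ltb_spec j m); [easy|lia].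
Qed.

Lemma csum_mono a m n : (forall j, 0 <= a j) -> (m <= n)%nat -> csum a m <= csum a n.
Proof.
  intros Ha Hmn. induction Hmn as [|n Hmn IH]; simpl; [lra|]. specialize (Ha n). lra.
Qed.

Lemma csum_trunc_le a m n : (forall j, 0 <= a j) -> (forall j, (n <= j)%nat -> a j = 0) ->
  csum a m <= csum a n.
Proof.
  intros Ha Hn. induction m as [|m IH]; [apply csum_nonneg; auto|].
  destruct (Nat.le_gt_cases n m) as [H|H]; [simpl; rewrite (Hn m H); lra|].
  now apply csum_mono.
Qed.

Lemma csum_ge_term a m j : (forall i, 0 <= a i) -> (j < m)%nat -> a j <= csum a m.
Proof.
  intros Ha. induction m as [|m IH]; intros Hj; [lia|]. simpl.
  destruct (Nat.eq_dec j m) as [->|].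
  - pose proof (csum_nonneg a m (fun i _ => Ha i)). lra.
  - specialize (IH ltac:(lia)). specialize (Ha m). lra.
Qed.

Section LimitSeminorm.
Variable X : Banach.
Variable U : (nat -> Prop) -> Prop.
Hypothesis HU : free_ultrafilter U.
Variable v : nat -> nat -> X.
Variable B : R.
Hypothesis HB : forall l j, snorm X (v l j) <= B.

(** Summing [l] terms at stage l avoids choosing a bound for the support: for large l the whole
    support is covered. *)
Lemma fs_limit_exists (a : finsupp) :
  exists r, ucv U (fun l => snorm X (lincomb (proj1_sig a) (v l) l)) r.
Proof.
  destruct a as [a [n Hn]]; simpl.
  assert (HB0 : 0 <= B) by (apply Rle_trans with (2 := HB 0%nat 0%nat), snorm_nonneg).
  apply (ucv_exists U HU _ (B * csum (fun j => Rabs (a j)) n)). intros l.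
  rewrite Rabs_pos_eq by apply snorm_nonneg.
  apply Rle_trans with (B * csum (fun j => Rabs (a j)) l); [now apply snorm_lincomb_le|].
  apply Rmult_le_compat_l; [assumption|]. apply csum_trunc_le.
  - intros j. apply Rabs_pos.
  - intros j Hj. now rewrite Hn, Rabs_R0.
Qed.

Definition fs_norm (a : finsupp) : R :=
  proj1_sig (constructive_indefinite_description _ (fs_limit_exists a)).

Lemma fs_norm_spec a : ucv U (fun l => snorm X (lincomb (proj1_sig a) (v l) l)) (fs_norm a).
Proof. apply (proj2_sig (constructive_indefinite_description _ (fs_limit_exists a))). Qed.

Definition fs_seminormed : Seminormed.
Proof.
  refine (Build_Seminormed fs_space fs_norm _ _).
  - intros a b.
    apply (ucv_le U HU _ _ _ _ (fs_norm_spec _) (ucv_add U HU _ _ _ _ (fs_norm_spec a) (fs_norm_spec b))).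
    apply (uf_all U HU). intros l. simpl. rewrite lincomb_plus. apply snorm_triangle.
  - intros c a. apply (ucv_unique U HU _ _ _ (fs_norm_spec _)).
    apply (ucv_ext U HU (fun l => Rabs c * snorm X (lincomb (proj1_sig a) (v l) l))).
    + apply (uf_all U HU). intros l. simpl. now rewrite lincomb_scal, snorm_homog.
    + apply (ucv_scal U HU). apply fs_norm_spec.
Defined.

Lemma fs_seminormed_lincomb a m :
  ucv U (fun l => snorm X (lincomb a (v l) m)) (snorm fs_seminormed (lincomb a fs_unit m)).
Proof.
  apply (ucv_ext U HU _ _ _) with (2 := fs_norm_spec _).
  apply (uf_mono U HU (fun l => (m <= l)%nat)); [|apply (uf_free U HU)].
  intros l Hl. f_equal.
  rewrite (lincomb_trunc X _ _ m l Hl).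
  - apply lincomb_ext; [|reflexivity]. intros j Hj. rewrite lincomb_fs_unit.
    destruct (Nat.ltb_spec j m); [reflexivity|lia].
  - intros j Hj. rewrite lincomb_fs_unit. destruct (Nat.ltb_spec j m); [lia|reflexivity].
Qed.

End LimitSeminorm.

(** * The case of an [l^1] spreading model *)

Lemma interval_net eps n :
  0 < eps -> exists G, forall c, -1 <= c <= -1 + INR n * eps -> exists g, In g G /\ Rabs (c - g) <= eps.
Proof.
  intros He. induction n as [|n [G HG]].
  - exists [-1]. intros c Hc. simpl in Hc. exists (-1). split; [now left|].
    apply Rabs_le. lra.
  - exists ((-1 + INR n * eps) :: G). intros c Hc. rewrite S_INR in Hc.
    destruct (Rle_lt_dec c (-1 + INR n * eps)) as [H|H].
    + destruct (HG c) as (g & Hg & Hcg); [lra|]. exists g. split; [now right|assumption].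
    + exists (-1 + INR n * eps). split; [now left|]. apply Rabs_le. lra.
Qed.

Lemma cube_net eps m : 0 < eps -> exists F : list (nat -> R),
  forall a, (forall j, (j < m)%nat -> -1 <= a j <= 1) ->
  exists b, In b F /\ forall j, (j < m)%nat -> Rabs (a j - b j) <= eps.
Proof.
  intros He. destruct (INR_unbounded (2 / eps)) as [n Hn].
  destruct (interval_net eps n He) as [G HG].
  assert (HnG : 1 <= -1 + INR n * eps).
  { apply (Rmult_gt_compat_r eps) in Hn; [|assumption].
    replace (2 / eps * eps) with 2 in Hn by (field; lra). lra. }
  induction m as [|m [F HF]].
  - exists [fun _ => 0]. intros a _. exists (fun _ => 0). split; [now left|]. intros j Hj. lia.
  - exists (flat_map (fun b => map (fun g j => if Nat.eqb j m then g else b j) G) F).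
    intros a Ha. destruct (HF a) as (b & Hb & Hab); [auto|].
    destruct (HG (a m)) as (g & Hg & Hag).
    { specialize (Ha m (Nat.lt_succ_diag_r m)). lra. }
    exists (fun j => if Nat.eqb j m then g else b j). split.
    + apply in_flat_map. exists b. split; [assumption|]. apply in_map_iff. eauto.
    + intros j Hj. destruct (Nat.eqb_spec j m) as [->|]; [assumption|]. apply Hab. lia.
Qed.

(** A concrete plegma family using one block of [l] positions of M per coordinate. Starting with
    block 1 instead of 0 places it beyond [M l]. *)
Definition staircase (M : nat -> nat) (k l j : nat) : list nat :=
  map (fun i => M (S i * l + j)%nat) (seq 0 k).

Lemma nth_staircase M k l j i : (i < k)%nat -> nth i (staircase M k l j) 0%nat = M (S i * l + j)%nat.
Proof.
  intros Hi. unfold staircase. rewrite nth_map_lt by (now rewrite length_seq).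
  now rewrite seq_nth.
Qed.

Lemma staircase_plegma M k l m : infinite_enum M -> (m <= l)%nat ->
  plegma M k m (staircase M k l).
Proof.
  intros HM Hml.
  assert (Hlen : forall j, length (staircase M k l j) = k)
    by (intros j; unfold staircase; now rewrite length_map, length_seq).
  repeat split.
  - apply Hlen.
  - intros i. rewrite Hlen. intros Hi. rewrite !nth_staircase by lia.
    apply infinite_enum_lt; [assumption|]. nia.
  - intros i Hi. rewrite nth_staircase by assumption. eauto.
  - intros i j Hi Hj. rewrite !nth_staircase by assumption.
    apply infinite_enum_lt; [assumption|]. lia.
  - intros i Hi Hm. rewrite !nth_staircase by lia.
    apply infinite_enum_lt; [assumption|]. nia.
Qed.

Lemma ksubset_of_nat M k s : ksubset_of M k s -> ksubset_of (fun i => i) k s.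
Proof. intros (H1 & H2 & _). repeat split; auto. intros i _. eauto. Qed.

Section SpreadingModel.
Variable X : Banach.
Variable U : (nat -> Prop) -> Prop.
Hypothesis HU : free_ultrafilter U.
Variable B : R.
Variable x' : list nat -> X.
Hypothesis HB : forall s, snorm X (x' s) <= B.
Variable k : nat.
Hypothesis Hk : (1 <= k)%nat.

Lemma plegma_norm_lipschitz m a b e u : (forall j, (j < m)%nat -> Rabs (a j - b j) <= e) ->
  Rabs (plegma_norm X x' k m a u - plegma_norm X x' k m b u) <= B * (INR m * e).
Proof.
  intros Hab. unfold plegma_norm.
  apply Rle_trans with (1 := snorm_sub_triangle X _ _).
  set (w := fun j => x' (pick m k j u)).
  replace (lincomb a w m ⊖ lincomb b w m) with (lincomb (fun j => a j + -1 * b j) w m).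
  2:{ rewrite lincomb_plus, lincomb_scal. vring. }
  apply Rle_trans with (B * csum (fun j => Rabs (a j + -1 * b j)) m).
  - apply snorm_lincomb_le. intros; apply HB.
  - apply Rmult_le_compat_l; [apply Rle_trans with (2 := HB []), snorm_nonneg|].
    assert (Hc : csum (fun _ => e) m = INR m * e).
    { clear. induction m as [|m IH]; [simpl; ring|]. rewrite S_INR. simpl csum. rewrite IH. ring. }
    rewrite <- Hc. apply csum_le. intros j Hj. replace (a j + -1 * b j) with (a j - b j) by ring. auto.
Qed.

(** Finitely many coefficient vectors can be treated simultaneously, so a finite net of the cube
    suffices: both the norm and its limit vary by at most delta / 4 between a vector and its net
    point, where the error is below delta / 2. *)
Lemma iter_uf_plegma_norm_uniform m (N : (nat -> R) -> R) delta : 0 < delta ->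
  (forall a, iter_ucv U (m * k) (plegma_norm X x' k m a) [] (N a)) ->
  iter_uf U (m * k) (fun u => forall a, (forall j, (j < m)%nat -> -1 <= a j <= 1) ->
     Rabs (plegma_norm X x' k m a u - N a) <= delta) [].
Proof.
  intros Hd HN.
  assert (HB0 : 0 <= B) by (apply Rle_trans with (2 := HB []), snorm_nonneg).
  assert (Hm0 : 0 <= B * INR m) by (apply Rmult_le_pos; [assumption|apply pos_INR]).
  set (e := delta / (4 * (B * INR m + 1))).
  assert (He : 0 < e) by (apply Rdiv_lt_0_compat; lra).
  assert (Hee : B * (INR m * e) <= delta / 4).
  { replace (delta / 4) with ((B * INR m + 1) * e) by (unfold e; field; lra). lra. }
  destruct (cube_net e m He) as [F HF].
  apply (iter_uf_mono U HU (m * k) (fun u => forall b, In b F -> Rabs (plegma_norm X x' k m b u - N b) < delta / 2)).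
  - intros u _ Hu a Ha. destruct (HF a Ha) as (b & Hb & Hab). specialize (Hu b Hb).
    pose proof (plegma_norm_lipschitz m a b e u Hab) as H1.
    assert (H2 : forall a b, (forall j, (j < m)%nat -> Rabs (a j - b j) <= e) -> N a - N b <= delta / 4).
    { clear - HU HN HB Hee. intros a b Hab.
      assert (H : N a <= 1 * N b + 1 * (delta / 4)); [|lra].
      apply (iter_ucv_le U HU (m * k) (plegma_norm X x' k m a)
         (fun u => 1 * plegma_norm X x' k m b u + 1 * (delta / 4)) []); [apply HN| |].
      - apply (iter_ucv_lin U HU (m * k) 1 1 _ (fun _ => delta / 4)); [apply HN|now apply iter_ucv_const].
      - apply (iter_uf_all U HU). intros u _. pose proof (plegma_norm_lipschitz m a b e u Hab) as H.
        pose proof (Rle_abs (plegma_norm X x' k m a u - plegma_norm X x' k m b u)). lra. }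
    pose proof (H2 a b Hab) as H3. assert (H4 : N b - N a <= delta / 4).
    { apply H2. intros j Hj. rewrite Rabs_minus_sym. auto. }
    apply Rabs_def2 in Hu. pose proof (Rle_abs (plegma_norm X x' k m a u - plegma_norm X x' k m b u)) as H5.
    pose proof (Rle_abs (- (plegma_norm X x' k m a u - plegma_norm X x' k m b u))) as H6.
    rewrite Rabs_Ropp in H6. apply Rabs_le. lra.
  - apply (iter_uf_forall_In U HU). intros b _. apply HN. lra.
Qed.

Variable x : ksequence X.
Hypothesis Hxx : forall s, ksubset_of (fun i => i) k s -> x' s = x s.

Lemma l1_spreading_model (c : R) : 0 < c ->
  (forall m a N, iter_ucv U (m * k) (plegma_norm X x' k m a) [] N ->
     c * csum (fun j => Rabs (a j)) m <= N) ->
  exists M, infinite_enum M /\ exists (E : Seminormed) (e : nat -> E),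
    generates_spreading_model X k x M E e /\ equiv_l1_basis E e.
Proof.
  intros Hc Hlow.
  assert (HN : forall m, exists N, forall a, iter_ucv U (m * k) (plegma_norm X x' k m a) [] (N a)).
  { intros m. apply (choice (fun a r => iter_ucv U (m * k) (plegma_norm X x' k m a) [] r)). intros a.
    apply (iter_ucv_exists U HU _ _ (B * csum (fun j => Rabs (a j)) m)). intros u.
    unfold plegma_norm. rewrite Rabs_pos_eq by apply snorm_nonneg.
    apply snorm_lincomb_le. auto. }
  destruct (choice _ HN) as [N HN']. clear HN. cbv beta in HN'.
  set (delta := fun l => / (INR l + 1)).
  assert (Hdelta : forall l, 0 < delta l).
  { intros l. apply Rinv_0_lt_compat. pose proof (pos_INR l). lra. }
  assert (Hnull : forall eps, eps > 0 -> exists n, forall l, (l >= n)%nat -> delta l < eps).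
  { intros eps He. destruct (INR_unbounded (/ eps)) as [n Hn]. exists n. intros l Hl.
    unfold delta. rewrite <- (Rinv_inv eps). apply Rinv_lt_contravar.
    - apply Rmult_lt_0_compat; [now apply Rinv_0_lt_compat|]. pose proof (pos_INR l). lra.
    - apply le_INR in Hl. lra. }
  (* Condition l covers families of at most l + 1 sets starting at or beyond [M l], the range in the
     definition of a spreading model. Lengths that are not multiples of k carry a vacuous condition;
     k >= 1 makes m unique for the others. *)
  destruct (diagonal_subset U HU
    (fun l d u => forall m, d = (m * k)%nat -> forall a, (forall j, (j < m)%nat -> -1 <= a j <= 1) ->
       Rabs (plegma_norm X x' k m a u - N m a) <= delta l)
    (fun l => S l * k)%nat) as (M & HM & HMP).
  { intros l d. destruct (classic (exists m, d = (m * k)%nat)) as [[m ->]|Hno].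
    - apply (iter_uf_mono U HU) with (2 := iter_uf_plegma_norm_uniform m (N m) (delta l) (Hdelta l) (HN' m)).
      intros u _ Hu m' Hm'. replace m' with m by nia. exact Hu.
    - apply (iter_uf_all U HU). intros u _ m ->. destruct Hno. eauto. }
  assert (Hgen : forall l m s a, (m <= S l)%nat -> plegma M k m s -> (0 < m)%nat ->
    (M l <= nth 0 (s 0%nat) 0)%nat -> (forall j, (j < m)%nat -> -1 <= a j <= 1) ->
    Rabs (snorm X (lincomb a (fun j => x' (s j)) m) - N m a) <= delta l).
  { intros l m s a Hml Hpl Hm0 Hst Ha.
    assert (Heq : snorm X (lincomb a (fun j => x' (s j)) m) = plegma_norm X x' k m a (interleave m k s)).
    { unfold plegma_norm. f_equal. apply lincomb_ext; [reflexivity|]. intros j Hj.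
      now rewrite pick_interleave; [|assumption|apply Hpl]. }
    rewrite Heq. apply (HMP l (m * k)%nat); auto.
    - nia.
    - now apply interleave_plegma.
    - nia.
    - replace (nth 0 (interleave m k s) 0%nat) with (nth 0 (s 0%nat) 0%nat); [assumption|].
      symmetry. apply (nth_interleave m k s 0 0); lia. }
  exists M. split; [assumption|].
  set (v := fun l j => x' (staircase M k l j)).
  assert (Hv : forall l j, snorm X (v l j) <= B) by (intros; apply HB).
  set (E := fs_seminormed X U HU v B Hv).
  (* Stage l of the seminorm is evaluated on the staircase at l, a plegma family beyond [M l], so
     the uniform estimate identifies the limit with [N m a] on the cube. *)
  assert (HE : forall m a, (0 < m)%nat -> (forall j, (j < m)%nat -> -1 <= a j <= 1) ->
    snorm E (lincomb a fs_unit m) = N m a).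
  { intros m a Hm Ha.
    apply (ucv_unique U HU _ _ _ (fs_seminormed_lincomb X U HU v B Hv a m)).
    intros eps He. destruct (Hnull eps He) as [n Hn].
    apply (uf_mono U HU (fun l => (max n m <= l)%nat)); [|apply (uf_free U HU)].
    intros l Hl. apply Rle_lt_trans with (delta l); [|apply Hn; lia].
    apply Hgen; auto; try lia.
    - apply staircase_plegma; [assumption|lia].
    - rewrite nth_staircase by lia. apply infinite_enum_le; [assumption|lia]. }
  exists E, fs_unit. split.
  - split; [exact fs_unit_hamel|]. exists delta. split; [exact Hdelta|]. split; [exact Hnull|].
    intros l m s a Hml Hpl Hm0 Hst Ha.
    replace (snorm E (lincomb a (fs_unit : nat -> E) m)) with (N m a) by (symmetry; now apply HE).
    replace (lincomb a (fun j => x (s j)) m) with (lincomb a (fun j => x' (s j)) m).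
    + now apply Hgen.
    + apply lincomb_ext; [reflexivity|]. intros j Hj. apply Hxx.
      apply (ksubset_of_nat M). now apply Hpl.
  - exists c, B. split; [assumption|]. intros m a. rewrite csum_abs_fold. split.
    + destruct (Nat.eq_dec m 0) as [->|Hm].
      * simpl csum. rewrite Rmult_0_r. apply snorm_nonneg.
      (* Dividing by T moves the coefficients into the cube, where the seminorm is known to be [N];
         the summand 1 keeps T positive. *)
      * set (T := 1 + csum (fun j => Rabs (a j)) m).
        assert (HT : 1 <= T).
        { unfold T. pose proof (csum_nonneg (fun j => Rabs (a j)) m (fun j _ => Rabs_pos _)). lra. }
        set (b := fun j => / T * a j).
        assert (Hb : forall j, (j < m)%nat -> -1 <= b j <= 1).
        { intros j Hj. pose proof (csum_ge_term (fun j => Rabs (a j)) m j (fun i => Rabs_pos _) Hj) as H.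
          cbv beta in H.
          assert (Hbj : Rabs (b j) <= 1).
          { unfold b. rewrite Rabs_mult, Rabs_pos_eq by (left; apply Rinv_0_lt_compat; lra).
            apply (Rmult_le_reg_l T); [lra|]. rewrite <- Rmult_assoc, Rinv_r by lra. unfold T. lra. }
          pose proof (Rle_abs (b j)). pose proof (Rle_abs (- b j)) as H'. rewrite Rabs_Ropp in H'. lra. }
        pose proof (Hlow m b (N m b) (HN' m b)) as H.
        rewrite <- HE in H by (assumption || lia).
        assert (H1 : snorm E (lincomb b (fs_unit : nat -> E) m) = / T * snorm E (lincomb a (fs_unit : nat -> E) m)).
        { unfold b. rewrite lincomb_scal, snorm_homog, Rabs_pos_eq; [reflexivity|].
          left; apply Rinv_0_lt_compat; lra. }
        assert (H2 : csum (fun j => Rabs (b j)) m = / T * csum (fun j => Rabs (a j)) m).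
        { rewrite <- csum_scal. apply csum_ext. intros j _. unfold b.
          rewrite Rabs_mult, (Rabs_pos_eq (/ T)); [reflexivity|]. left; apply Rinv_0_lt_compat; lra. }
        change (c * csum (fun j => Rabs (b j)) m <= snorm E (lincomb b (fs_unit : nat -> E) m)) in H.
        rewrite H1, H2 in H. apply (Rmult_le_compat_l T) in H; [|lra].
        replace (T * (c * (/ T * csum (fun j => Rabs (a j)) m))) with (c * csum (fun j => Rabs (a j)) m) in H by (field; lra).
        rewrite <- Rmult_assoc, Rinv_r, Rmult_1_l in H by lra. exact H.
    + apply (ucv_le U HU _ (fun _ => B * csum (fun j => Rabs (a j)) m) _ _
        (fs_seminormed_lincomb X U HU v B Hv a m) (ucv_const U HU _)).
      apply (uf_all U HU). intros l. apply snorm_lincomb_le. auto.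
Qed.

End SpreadingModel.

(** * The Cesàro summable case *)

Lemma ksubsets_seq k a n p : In p (ksubsets k (seq a n)) ->
  strictly_inc p /\ forall b, In b p -> (a <= b)%nat.
Proof.
  revert k a p. induction n as [|n IH]; intros [|k] a p; simpl.
  - intros [<-|[]]. split; [intros i; simpl; lia|intros b []].
  - intros [].
  - intros [<-|[]]. split; [intros i; simpl; lia|intros b []].
  - rewrite in_app_iff, in_map_iff. intros [(q & <- & Hq)|H].
    + destruct (IH _ _ _ Hq) as [H1 H2]. split.
      * intros [|i]; simpl; intros Hi.
        -- apply H2, nth_In. lia.
        -- apply H1. lia.
      * intros b [<-|Hb]; [lia|]. specialize (H2 b Hb). lia.
    + destruct (IH _ _ _ H) as [H1 H2]. split; [assumption|].
      intros b Hb. specialize (H2 b Hb). lia.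
Qed.

Lemma ksubset_of_map L k n p : infinite_enum L -> In p (ksubsets k (seq 0 n)) ->
  ksubset_of (fun i => i) k (map L p).
Proof.
  intros HL Hp. pose proof (ksubsets_length _ _ _ Hp) as Hlen.
  destruct (ksubsets_seq _ _ _ _ Hp) as [Hinc _]. split; [now rewrite length_map|]. split.
  - intros i. rewrite length_map. intros Hi. rewrite !nth_map_lt by lia.
    apply infinite_enum_lt; [assumption|]. now apply Hinc.
  - intros i _. eauto.
Qed.

Lemma linear_vsum_list (V : VecSpace) (f : V -> R) :
  (forall x y, f (x ⊕ y) = f x + f y) -> (forall a x, f (a ⊙ x) = a * f x) ->
  forall l, f (vsum_list l) = rsum (map f l).
Proof.
  intros Ha Hs l. induction l as [|v l IH]; simpl; [now apply linear_zero|].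
  unfold vsum_list in *. simpl. now rewrite Ha, IH.
Qed.

Section Cesaro.
Variable X : Banach.
Variable B : R.
Variable x' : list nat -> X.
Hypothesis HB : forall s, snorm X (x' s) <= B.
Variable x0 : X.
Hypothesis HB0 : snorm X x0 <= B.
Variable k : nat.
Variable M : nat -> nat.
Hypothesis HM : infinite_enum M.
Hypothesis Hsep : forall th, 0 < th -> exists m i0, (0 < m)%nat /\
  forall u, ksubset_of M (m * S k) u -> (M i0 <= nth 0 u 0)%nat ->
  ~ exists f, dual_ball X f /\ forall j, (j < m)%nat -> th <= f (x' (pick m (S k) j u)) - f x0.
Variable x : ksequence X.
Hypothesis Hxx : forall s, ksubset_of (fun i => i) (S k) s -> x' s = x s.
Variable L : nat -> nat.
Hypothesis HL : infinite_enum L.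
Hypothesis HLM : sub_enum L M.

(** The order of quantifiers matters: [m] and [i0] depend on [th] alone, so the bound is uniform in
    f, and W can be taken large compared with m. *)
Lemma cesaro_functional_bound (th : R) : 0 < th ->
  exists m i0, forall W n f, (1 <= W)%nat -> dual_ball X f ->
    INR W * ksum (fun p => f (x' (map L p)) - f x0) (S k) (seq 0 n) <=
      INR (bin n (S k)) * (INR m * (2 * B) + INR W * th)
      + INR W * (2 * B) * (2 * INR W + INR (k * W + i0)) * INR (bin n k).
Proof.
  intros Hth. destruct (Hsep th Hth) as (m & i0 & Hm & Hno). exists m, i0.
  intros W n f HW Hf. set (y := fun p => f (x' (map L p)) - f x0).
  assert (HB00 : 0 <= B) by (apply Rle_trans with (2 := HB0), snorm_nonneg).
  assert (Hy : forall p, Rabs (y p) <= 2 * B).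
  { intros p. unfold y. pose proof (Rabs_triang (f (x' (map L p))) (- f x0)) as H.
    rewrite Rabs_Ropp in H. pose proof (proj2 (proj2 Hf) (x' (map L p))) as H1.
    pose proof (proj2 (proj2 Hf) x0) as H2. specialize (HB (map L p)). unfold Rminus. lra. }
  apply ksum_window_bound; try assumption; try lra.
  { pose proof (pos_INR m). pose proof (pos_INR W). nra. }
  intros p Hp Hsp.
  pose proof (rsum_few_large (fun h => y (map (Nat.add h) p)) (2 * B) th (seq 0 W) ltac:(lra)) as Hfew.
  cbv beta in Hfew. rewrite length_seq in Hfew.
  set (test := fun h => if Rle_lt_dec th (y (map (Nat.add h) p)) then true else false) in *.
  set (hs := filter test (seq 0 W)) in *.
  destruct (Nat.le_gt_cases m (length hs)) as [Hlong|Hshort].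
  - exfalso. pose proof (ksubsets_length _ _ _ Hp) as Hlen.
    assert (Hhs : forall h, In h hs -> (h < W)%nat /\ th <= y (map (Nat.add h) p)).
    { intros h Hh. apply filter_In in Hh. destruct Hh as [H1 H2]. apply in_seq in H1.
      split; [lia|]. unfold test in H2. now destruct Rle_lt_dec. }
    set (s := fun j => map L (map (Nat.add (nth j hs 0%nat)) p)).
    assert (Hpl : plegma M (S k) m s).
    { apply (translates_plegma L M W i0); auto.
      - intros h Hh. now apply Hhs.
      - apply filter_seq_increasing. }
    apply (Hno (interleave m (S k) s)).
    + now apply interleave_plegma.
    + replace (nth 0 (interleave m (S k) s) 0%nat) with (nth 0 (s 0%nat) 0%nat)
        by (symmetry; apply (nth_interleave m (S k) s 0 0); lia).
      unfold s. rewrite !nth_map_lt by (rewrite ?length_map; lia).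
      (* Spacing with [lo] = i0 gives p(0) >= i0, so the family starts at or beyond L i0, which is
         at least M i0. *)
      apply Nat.le_trans with (L i0); [now apply sub_enum_ge|].
      apply infinite_enum_le; [assumption|].
      pose proof (proj2 (spaced_nth _ _ _ Hsp) ltac:(lia)). lia.
    + exists f. split; [assumption|]. intros j Hj.
      rewrite pick_interleave; [|assumption|apply Hpl; assumption].
      apply (Hhs (nth j hs 0%nat)). apply nth_In. lia.
  - apply Rle_trans with (1 := Hfew (fun h => Rle_trans _ _ _ (Rle_abs _) (Hy _))).
    apply Rplus_le_compat_r, Rmult_le_compat_r; [lra|]. apply le_INR. lia.
Qed.

Lemma cesaro_summable_of_not_separated : cesaro_summable X (S k) x L x0.
Proof.
  intros eps He. destruct (cesaro_functional_bound (eps / 4) ltac:(lra)) as (m & i0 & Hbound).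
  assert (HB00 : 0 <= B) by (apply Rle_trans with (2 := HB0), snorm_nonneg).
  pose proof (pos_INR m) as Hm.
  (* There are three errors of eps / 4: the threshold, the fewer than m large translates out of W,
     and the boundary terms. W is fixed by m, and n0 then by W; the successor ensures W >= 1. *)
  destruct (INR_unbounded (INR m * (2 * B) * 4 / eps)) as [W0 HW0].
  set (W := S W0).
  assert (HW : INR m * (2 * B) <= INR W * (eps / 4)).
  { assert (H : INR m * (2 * B) * 4 / eps <= INR W) by (unfold W; rewrite S_INR; lra).
    apply (Rmult_le_compat_r (eps / 4)) in H; [|lra].
    replace (INR m * (2 * B) * 4 / eps * (eps / 4)) with (INR m * (2 * B)) in H by (field; lra). exact H. }
  assert (HWpos : 0 < INR W) by (unfold W; rewrite S_INR; pose proof (pos_INR W0); lra).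
  set (D := 2 * B * (2 * INR W + INR (k * W + i0))).
  assert (HD : 0 <= D).
  { unfold D. pose proof (pos_INR (k * W + i0)). apply Rmult_le_pos; lra. }
  destruct (INR_unbounded (INR (S k) * D * 4 / eps)) as [n0 Hn0].
  exists (n0 + S k)%nat. intros n Hn.
  assert (Hbin : INR (S k) * INR (bin n (S k)) = INR (n - k) * INR (bin n k)).
  { rewrite <- !mult_INR. f_equal. pose proof (bin_absorb n k). rewrite Nat.mul_sub_distr_r. lia. }
  assert (Hbpos : 0 < INR (bin n (S k))) by (apply lt_0_INR, bin_pos; lia).
  assert (Hsmall : D * INR (bin n k) <= eps / 4 * INR (bin n (S k))).
  { apply (Rmult_le_reg_l (INR (S k))); [apply lt_0_INR; lia|].
    replace (INR (S k) * (eps / 4 * INR (bin n (S k)))) with (eps / 4 * (INR (S k) * INR (bin n (S k)))) by ring.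
    rewrite Hbin.
    replace (INR (S k) * (D * INR (bin n k))) with (INR (S k) * D * INR (bin n k)) by ring.
    rewrite <- Rmult_assoc. apply Rmult_le_compat_r; [apply pos_INR|].
    assert (H : INR (S k) * D * 4 / eps <= INR (n - k)).
    { apply Rlt_le, Rlt_le_trans with (1 := Hn0). apply le_INR. lia. }
    apply (Rmult_le_compat_r (eps / 4)) in H; [|lra].
    replace (INR (S k) * D * 4 / eps * (eps / 4)) with (INR (S k) * D) in H by (field; lra). lra. }
  rewrite <- bin_C by lia.
  set (z := vsub _ _). destruct (norming_functional X z) as (f & Hf & Hfz).
  rewrite <- Hfz. pose proof Hf as (Ha & Hs & Hb).
  assert (Hz : INR (bin n (S k)) * f z = ksum (fun p => f (x' (map L p)) - f x0) (S k) (seq 0 n)).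
  { unfold z. rewrite (linear_sub _ f Ha Hs), Hs, (linear_vsum_list _ f Ha Hs).
    rewrite ksubsets_map, !map_map.
    assert (Hk : ksum (fun p => f (x' (map L p)) - f x0) (S k) (seq 0 n) =
      ksum (fun p => f (x (map L p)) + - f x0) (S k) (seq 0 n)).
    { unfold ksum. f_equal. apply map_ext_in. intros p Hp.
      rewrite Hxx by (now apply (ksubset_of_map L (S k) n)). ring. }
    rewrite Hk. unfold ksum. rewrite rsum_plus, rsum_const, length_ksubsets, length_seq. field. lra. }
  pose proof (Hbound W n f ltac:(lia) Hf) as H. rewrite <- Hz in H.
  assert (H1 : INR W * (INR (bin n (S k)) * f z) <= INR W * (INR (bin n (S k)) * (3 / 4 * eps))).
  { apply Rle_trans with (1 := H).
    assert (H2 : INR (bin n (S k)) * (INR m * (2 * B)) <= INR (bin n (S k)) * (INR W * (eps / 4)))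
      by (apply Rmult_le_compat_l; lra).
    assert (H3 : INR W * (D * INR (bin n k)) <= INR W * (eps / 4 * INR (bin n (S k))))
      by (apply Rmult_le_compat_l; lra).
    unfold D in H3. nra. }
  apply Rmult_le_reg_l in H1; [|assumption]. apply Rmult_le_reg_l in H1; [|assumption]. lra.
Qed.

End Cesaro.

Theorem mainTheorem15 (X : Banach) (k : nat) (x : ksequence X) :
  (1 <= k)%nat ->
  weakly_rel_compact_kseq X k x ->
  exists M : nat -> nat, infinite_enum M /\
    ((exists (E : Seminormed) (e : nat -> E),
        generates_spreading_model X k x M E e /\ equiv_l1_basis E e)
     \/
     (exists x0 : X, forall L : nat -> nat,
        infinite_enum L -> sub_enum L M -> cesaro_summable X k x L x0)).
Proof.
  intros Hk HK. destruct free_ultrafilter_exists as [U HU].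
  red in HK. set (K := weak_closure X _) in HK.
  destruct (weakly_compact_norm_bounded X U HU K HK) as [B HB].
  (* Iterated limits run over arbitrary lists, including nonincreasing ones, so [x] is given the
     default value [x (seq 0 k)] there; then all values lie in K. *)
  set (x' := fun s => if excluded_middle_informative (ksubset_of (fun i => i) k s) then x s else x (seq 0 k)).
  assert (Hin : forall s, ksubset_of (fun i => i) k s -> K (x s)).
  { intros s Hs V _ HV. eauto. }
  assert (Hx : forall s, K (x' s)).
  { intros s. unfold x'. destruct excluded_middle_informative as [H|_]; apply Hin; [assumption|].
    split; [apply length_seq|]. split; [|eauto].
    intros i. rewrite length_seq. intros Hi. rewrite !seq_nth by lia. lia. }
  assert (Hxx : forall s, ksubset_of (fun i => i) k s -> x' s = x s).
  { intros s Hs. unfold x'. now destruct excluded_middle_informative. }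
  clearbody x'.
  set (sep := separated X U K x' k).
  destruct (classic (exists th, 0 < th /\ forall m, iter_uf U (m * k) (sep th m) [])) as [(th & Hth & Hsep)|Hno].
  - destruct (l1_spreading_model X U HU B x' (fun s => HB _ (Hx s)) k Hk x Hxx (th / 4)) as (M & HM & HE).
    + lra.
    + intros m a N. apply (plegma_norm_lower X U HU K HK B HB x' Hx k th m a N Hth (Hsep m)).
    + exists M. split; [assumption|]. now left.
  (* The diagonal argument handles countably many conditions, so the thresholds are restricted to 1
     / (n + 1); separation at a larger th implies separation at a smaller one. *)
  - set (dl := fun n => / (INR n + 1)).
    assert (Hdl : forall n, 0 < dl n).
    { intros n. apply Rinv_0_lt_compat. pose proof (pos_INR n). lra. }
    assert (Hex : forall n, exists m, ~ iter_uf U (m * k) (sep (dl n) m) []).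
    { intros n. apply not_all_ex_not. intros H. apply Hno. eauto. }
    destruct (choice _ Hex) as [mm Hmm].
    destruct (diagonal_subset U HU (fun n d u => d = (mm n * k)%nat -> ~ sep (dl n) (mm n) u)
      (fun n => mm n * k)%nat) as (M & HM & HMP).
    { intros n d. destruct (Nat.eq_dec d (mm n * k)) as [->|Hne].
      - apply (iter_uf_mono U HU) with (2 := iter_uf_not U HU _ _ _ (Hmm n)). auto.
      - apply (iter_uf_all U HU). easy. }
    exists M. split; [assumption|]. right. exists (hat X U K x' k []).
    intros L HL HLM. destruct k as [|k]; [lia|].
    apply (cesaro_summable_of_not_separated X B x' (fun s => HB _ (Hx s)) _
      (HB _ (hat_in X U HU K HK x' Hx _ _)) k M HM); auto.
    intros th Hth. destruct (INR_unbounded (/ th)) as [n Hn].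
    assert (Hdth : dl n <= th).
    { unfold dl. rewrite <- (Rinv_inv th). apply Rinv_le_contravar.
      - now apply Rinv_0_lt_compat.
      - lra. }
    (* An empty family is separated by the zero functional, so failure of separation forces a
       positive number of sets. *)
    assert (Hm0 : (0 < mm n)%nat).
    { apply Nat.neq_0_lt_0. intros H0. apply (Hmm n). rewrite H0. simpl.
      exists (fun _ => 0). split; [|lia]. repeat split; intros; try ring.
      rewrite Rabs_R0. apply snorm_nonneg. }
    exists (mm n), n. split; [assumption|]. intros u Hu Hst (f & Hf & Hfj).
    apply (HMP n (mm n * S k)%nat u); auto; [nia|].
    exists f. split; [assumption|]. intros j Hj. specialize (Hfj j Hj). lra.
Qed.
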